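(* Assume that the distribution of $\xi$ is nonlattice, and that $\mathbb{E}\xi^2<\infty$ and $\mathbb{E}\eta<\infty$. Then, for any fixed $j\in\mathbb{N}$, $$V_j(t)-\frac{t^j}{j!\,m^j}\ \sim\ \frac{b_V\, j\, t^{j-1}}{(j-1)!\,m^{j-1}},\qquad t\to\infty,$$ where $m=\mathbb{E}\xi<\infty$ and $b_V:=m^{-1}\big(\mathbb{E}\xi^2/(2m)-\mathbb{E}\eta\big)\in\mathbb{R}$.
   Context: Let $(\xi_i,\eta_i)_{i\in\mathbb{N}}$ be independent copies of a random vector $(\xi,\eta)$ whose components are a.s. positive and arbitrarily dependent. Put $S_0:=0$, $S_i:=\xi_1+\cdots+\xi_i$ and $T_i:=S_{i-1}+\eta_i$ for $i\in\mathbb{N}$; the sequence $T:=(T_i)_{i\in\mathbb{N}}$ is called a perturbed random walk. General branching process generated by $T$: at time $0$ there is one individual, the ancestor, whose children (the first generation) have birth times given by the points of $T$. The first generation produces the second generation, the second produces the third, and so on: the shifts of the birth times of the children of an individual with respect to that individual's birth time are distributed according to a copy of $T$, the copies for different mothers are independent, and all individuals act independently of each other. For $j\in\mathbb{N}$ and $t\ge 0$, $N_j(t)$ denotes the number of the $j$th generation individuals with birth times $\le t$, and $V_j(t):=\mathbb{E}N_j(t)$ (with $V_j(t):=0$ for $t<0$). As usual, $f(t)\sim g(t)$ as $t\to\infty$ means that $\lim_{t\to\infty}(f(t)/g(t))=1$. The distribution of a positive random variable is called nonlattice if it is not concentrated on any lattice $(nd)_{n\in\mathbb{N}_0}$, $d>0$,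 where $\mathbb{N}_0=\mathbb{N}\cup\{0\}$.
   Formalization: When b_V = 0 the right-hand side is identically zero and the relation ~ (ratio tending to 1) is undefined; the formal statement asserts ~ for b_V ≠ 0, and for b_V = 0 asserts instead that V_j(t) − t^j/(j! m^j) = o(t^{j−1}). *)

(* Defs.v *)
From HB Require Import structures.
From mathcomp Require Import all_boot all_order all_algebra.
From mathcomp Require Import all_classical all_reals all_analysis.

Set Implicit Arguments.
Unset Strict Implicit.
Unset Printing Implicit Defensive.

Import Order.TTheory GRing.Theory Num.Theory.
Import numFieldNormedType.Exports.

Local Open Scope classical_set_scope.
Local Open Scope ring_scope.

(* The space R^nat of real sequences with its product sigma-algebra, i.e. the
   one generated by the coordinate maps. *)
Definition seq_cylinders (R : realType) : set (set (nat -> R)) :=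
  \bigcup_(i : nat) preimage_set_system setT (fun x : nat -> R => x i) measurable.

Definition rseq (R : realType) := g_sigma_algebraType (@seq_cylinders R).

Definition as_rseq (Om : Type) (R : realType) (X : nat -> Om -> R) (w : Om) :
    rseq R :=
  fun i => X i w.

Definition same_law d d' (Om : measurableType d) (E : measurableType d')
    (R : realType) (P : probability Om R) (X Y : Om -> E) : Prop :=
  forall A : set E, measurable A -> P (X @^-1` A) = P (Y @^-1` A).

Definition mutually_independent d d' (Om : measurableType d)
    (E : measurableType d') (R : realType) (P : probability Om R)
    (I : eqType) (X : I -> Om -> E) : Prop :=
  forall (J : seq I) (A : I -> set E), uniq J ->
    (forall i, i \in J -> measurable (A i)) ->
    P (\bigcap_(i in [set` J]) (X i @^-1` A i)) =
    (\prod_(i <- J) P (X i @^-1` A i))%E.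

(* Only the laws of the copies are constrained: [X] need not be independent
   of [Y], so that e.g. one of the copies may be [Y] itself. *)
Definition independent_copies d d' (Om : measurableType d)
    (E : measurableType d') (R : realType) (P : probability Om R)
    (I : eqType) (X : I -> Om -> E) (Y : Om -> E) : Prop :=
  mutually_independent P X /\ forall i, same_law P (X i) Y.

(* Indices are shifted by one: [perturbed_walk xi eta i] is
   T_(i+1) = xi_1 + ... + xi_i + eta_(i+1), where xi_(k+1), eta_(k+1) are
   [xi k], [eta k]. *)
Definition perturbed_walk (Om : Type) (R : realType)
    (xi eta : nat -> Om -> R) (i : nat) (w : Om) : R :=
  \sum_(k < i) xi k w + eta i w.

(* Individuals are labelled by finite words over nat (Ulam-Harris labels): the
   ancestor is [::], and the i-th child of u is [rcons u i].  [T u i] is the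
   birth time of [rcons u i] relative to the birth time of u; the k-th
   ancestor of u is [take k u]. *)
Definition birth_time (Om : Type) (R : realType)
    (T : seq nat -> nat -> Om -> R) (u : seq nat) (w : Om) : R :=
  \sum_(k < size u) T (take k u) (nth 0%N u k) w.

Definition generation_count (Om : Type) (R : realType)
    (T : seq nat -> nat -> Om -> R) (j : nat) (t : R) (w : Om) : \bar R :=
  counting [set u : seq nat | size u = j /\ birth_time T u w <= t].

Definition mean_count d (Om : measurableType d) (R : realType)
    (P : probability Om R) (T : seq nat -> nat -> Om -> R) (j : nat) (t : R) :
    \bar R :=
  (\int[P]_w generation_count T j t w)%E.

Definition nonlattice (R : realType) (mu : probability R R) : Prop :=
  forall a : R, 0 < a -> mu [set x | exists n : nat, x = n%:R * a] <> 1%E.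

(* f may a priori be infinite; the limits force it to be finite eventually. *)
Definition asymp_equiv (R : realType) (f : R -> \bar R) (g : R -> R) : Prop :=
  (f t * ((g t)^-1)%:E)%E @[t --> +oo] --> (1%E : \bar R).

Definition asymp_negligible (R : realType) (f : R -> \bar R) (g : R -> R) :
    Prop :=
  (f t * ((g t)^-1)%:E)%E @[t --> +oo] --> (0%E : \bar R).

(* Main.v *)
Require Import Defs.
From HB Require Import structures.
From mathcomp Require Import all_boot all_order all_algebra.
From mathcomp Require Import all_classical all_reals all_analysis.
From mathcomp Require Import measurable_realfun.
From mathcomp Require Import ring lra.

Set Implicit Arguments.
Unset Strict Implicit.
Unset Printing Implicit Defensive.

Import Order.TTheory GRing.Theory Num.Theory.
Import numFieldNormedType.Exports.

Local Open Scope classical_set_scope.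
Local Open Scope ring_scope.

(** The mean [V_1(t)] of the first generation is the renewal function of the
    walk with steps distributed like [xi], evaluated at [t - eta] and averaged
    over [eta]; the dependence within a pair is harmless because [T_(i+1)]
    involves [xi] only through earlier pairs than the one of [eta].  The core of
    the proof is the two-term expansion of that renewal function [U],
    [m U(t) - t -> E xi^2 / (2 m)].

    Put [R(t) = m U(t) - t], the mean overshoot of the level [t]
    ([excess]).  The renewal equation says that [R] is harmonic for the walk
    on [t >= 0], that is [E R(t - xi) = R(t)] ([excess_harmonic]); it equals [- t]
    for [t < 0], and [R(t) + t] is nondecreasing.  Integrating the harmonicity
    yields a conservation law: [E] of the integral of [R(t - y)] over [y] in
    [0, xi] is [E xi^2 / 2] for every [t >= 0] ([excess_conservation]).  So [R]
    is bounded, and it remains to see that it converges, as its limit is then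
    forced to be [E xi^2 / (2 m)].  Let [L] be the upper limit.  Where [R] is
    nearly [L], harmonicity makes it nearly [L] again a step further to the
    left, for steps near each point of the support of [xi]; since [xi] is not
    lattice, sums of such points become dense at infinity ([reachable_dense]), so
    [R] is nearly [L] along an arbitrarily long window ([maximum_window]).  The
    conservation law then gives [L m <= E xi^2 / 2].  Conversely, with the upper
    limit known, one low value of [R] would be followed by an interval of low
    values to its left and would violate the conservation law ([liminf_ge]).
    Averaging over [eta] gives [V_1(t) = t / m + b_V + o(1)]
    ([delayed_renewal_cvg]).

    For the later generations, an individual of generation [j] born at [x] has
    on average [V_1(t - x)] children born before [t], because its descendants
    do not depend on its birth time.  So [V_(j+1)(t)] is the sum of
    [E V_1(t - x)] over the birth times [x] of generation [j]
    ([mean_count_rec]).  Replacing [V_1(s)] by [s / m + b_V] for [s >= 0] and using that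
    the sum of [E (t - x)^+] is the integral of [V_j] over [0, t], one finds
    [V_(j+1)(t) = (1 / m) * integral of V_j over [0, t] + b_V V_j(t)] up to
    [o(t^j)]: the error is [o(1) V_j(t)] plus a multiple of an increment of [V_j]
    over a bounded length ([campbell_kernel]).  The coefficients
    of the two leading powers follow by induction on [j]
    ([mean_count_expansion]). *)

(** * Integrals of nonnegative real functions *)

Lemma nondecreasing_emeasurable (R : realType) (f : R -> \bar R) :
  {homo f : x y / (x <= y)%R >-> (x <= y)%E} -> measurable_fun [set: R] f.
Proof.
move=> ndf; apply: (measurability _ (ErealGenCInfty.measurableE R)) => //.
move=> _ [_ [r ->] <-]; apply: measurableI => //.
apply: is_interval_measurable => s t/=.
rewrite !in_itv/= !andbT => fs ft u /andP[su ut].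
by rewrite in_itv/= andbT (le_trans fs)// ndf.
Qed.

Section realint.
Context d (T : measurableType d) (R : realType).
Variables (mu : {measure set T -> \bar R}) (D : set T) (mD : measurable D).
Implicit Types f g : T -> R.
Local Open Scope ereal_scope.

Lemma ge0_le_realint f g : measurable_fun D f -> measurable_fun D g ->
  (forall x, D x -> (0 <= f x)%R) -> (forall x, D x -> (f x <= g x)%R) ->
  \int[mu]_(x in D) (f x)%:E <= \int[mu]_(x in D) (g x)%:E.
Proof.
move=> mf mg f0 fg; apply: ge0_le_integral => //.
- exact/measurable_EFinP.
- exact/measurable_EFinP.
Qed.

Lemma ge0_realintD f g : measurable_fun D f -> measurable_fun D g ->
  (forall x, D x -> (0 <= f x)%R) -> (forall x, D x -> (0 <= g x)%R) ->
  \int[mu]_(x in D) (f x + g x)%:E =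
  \int[mu]_(x in D) (f x)%:E + \int[mu]_(x in D) (g x)%:E.
Proof.
move=> mf mg f0 g0; rewrite -ge0_integralD//.
- exact/measurable_EFinP.
- exact/measurable_EFinP.
Qed.

Lemma ge0_realintZ (k : R) f : (0 <= k)%R -> measurable_fun D f ->
  (forall x, D x -> (0 <= f x)%R) ->
  \int[mu]_(x in D) (k * f x)%:E = k%:E * \int[mu]_(x in D) (f x)%:E.
Proof.
move=> k0 mf f0; rewrite -ge0_integralZl_EFin//.
exact/measurable_EFinP.
Qed.

Lemma realint_cst (c : R) : \int[mu]_(x in D) c%:E = c%:E * mu D.
Proof. exact: integral_cst. Qed.

(** Monotone convergence over the sets [X <= n].  It truncates averages over a
    step or a delay; the integrand is a polynomial of degree at most two in [X]. *)
Lemma realint_tail (X : T -> R) f : measurable_fun D X -> measurable_fun D f ->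
  (forall x, D x -> (0 <= f x)%R) -> \int[mu]_(x in D) (f x)%:E < +oo ->
  forall e : R, (0 < e)%R -> exists2 W : R, (0 < W)%R &
  \int[mu]_(x in D) (if W < X x then f x else 0)%R%:E <= e%:E.
Proof.
move=> mX mf f0 fi e e0.
pose F (n : nat) := D `&` [set x | (X x <= n%:R)%R].
have mF n : measurable (F n).
  rewrite /F (_ : [set x | _] = X @^-1` `]-oo, n%:R]); first exact: mX.
  by apply/seteqP; split => x /=; rewrite in_itv.
have UF : \bigcup_n F n = D.
  apply/seteqP; split => [x [n _ []]//|x Dx].
  exists (Num.truncn (X x)).+1 => //; split => //=.
  exact/ltW/truncnS_gt.
have fge0 x : D x -> 0 <= (f x)%:E by move=> Dx; rewrite lee_fin f0.
have mfF : measurable_fun D (fun x => (f x)%:E) by exact/measurable_EFinP.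
have ndF : nondecreasing_seq F.
  by move=> n k nk; apply/subsetPset => x [Dx /= xn]; split => //=;
    rewrite (le_trans xn)// ler_nat.
have mfn n : measurable_fun (F n) (fun x => (f x)%:E).
  by apply: (@measurable_funS _ _ _ _ D) => // x [].
have fn0 n x : F n x -> 0 <= (f x)%:E by move=> [Dx _]; exact: fge0.
have := @ge0_nondecreasing_set_cvg_integral _ T R F _ mu ndF mF mfn fn0.
rewrite UF => cvF.
have fin : \int[mu]_(x in D) (f x)%:E \is a fin_num.
  by rewrite ge0_fin_numE// integral_ge0.
have [n hn] : exists n : nat, \int[mu]_(x in D) (f x)%:E - e%:E <
    \int[mu]_(x in F n) (f x)%:E.
  move: cvF; rewrite -(fineK fin) => /fine_cvgP[_].
  set l := fine _ => cv.
  have le : (l - e < l)%R by rewrite ltrBlDr ltrDl.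
  have := cvgr_gt l cv (l - e)%R le.
  case => n _ /(_ n (leqnn n))/= h; exists n.
  rewrite -EFinB.
  have finn : \int[mu]_(x in F n) (f x)%:E \is a fin_num.
    rewrite ge0_fin_numE; last by apply: integral_ge0 => x [Dx _]; exact: fge0.
    apply: le_lt_trans fi; apply: ge0_subset_integral => //.
    by move=> x [].
  by rewrite -(fineK finn) lte_fin.
exists (n%:R + 1)%R; first by rewrite ltr_wpDl.
pose g x : R := if (X x <= n%:R)%R then f x else 0%R.
pose h x : R := if (n%:R + 1 < X x)%R then f x else 0%R.
have mg : measurable_fun D g.
  apply: measurable_fun_if => //.
    exact: measurable_fun_ler.
  by apply: (@measurable_funS _ _ _ _ D) => // x [].
have mh : measurable_fun D h.
  apply: measurable_fun_if => //.
    exact: measurable_fun_ltr.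
  by apply: (@measurable_funS _ _ _ _ D) => // x [].
have : \int[mu]_(x in D) (h x + g x)%:E <= \int[mu]_(x in D) (f x)%:E.
  apply: ge0_le_realint => //.
  - exact: measurable_funD.
  - by move=> x Dx; rewrite /h /g addr_ge0//; case: ifP => // _; exact: f0.
  - move=> x Dx; rewrite /h /g.
    case: (ltP (n%:R + 1)%R (X x)) => h1; case: (leP (X x) n%:R) => h2.
    + by exfalso; move: (lt_le_trans h1 h2); rewrite -subr_gt0; lra.
    + by rewrite addr0.
    + by rewrite add0r.
    + by rewrite addr0 f0.
rewrite ge0_realintD//; last 2 first.
- by move=> x Dx; rewrite /h; case: ifP => // _; exact: f0.
- by move=> x Dx; rewrite /g; case: ifP => // _; exact: f0.
have -> : \int[mu]_(x in D) (g x)%:E = \int[mu]_(x in F n) (f x)%:E.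
  rewrite /F integral_mkcondr; apply: eq_integral => x _.
  rewrite /patch /g; case: ifPn => h1; case: ifPn => //.
    by rewrite notin_setE /= h1.
  by rewrite inE/= (negbTE h1).
move=> le1; move: hn; rewrite lteBlDr//.
move: le1 fin; set a := \int[mu]_(x in D) _; set c := \int[mu]_(x in D) _.
set b := \int[mu]_(x in _) _ => le1 fin lt1.
have bfin : b \is a fin_num.
  rewrite ge0_fin_numE; last by apply: integral_ge0 => x [Dx _]; exact: fge0.
  apply: le_lt_trans fi; apply: ge0_subset_integral => //.
  by move=> x [].
have afin : a \is a fin_num.
  rewrite ge0_fin_numE; last first.
    by apply: integral_ge0 => x Dx; rewrite lee_fin /h; case: ifP => // _; exact: f0.
  apply: le_lt_trans fi; apply: le_trans le1.
  by rewrite leeDl//; apply: integral_ge0 => x [Dx _]; exact: fge0.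
move: le1 lt1; rewrite -(fineK afin) -(fineK bfin) -(fineK fin).
by rewrite -!EFinD !lee_fin lte_fin; lra.
Qed.

End realint.
(** * Lebesgue integrals over intervals *)

Section lebesgue.
Variable R : realType.
Notation leb := (@lebesgue_measure R).
Implicit Types f : R -> \bar R.
Local Open Scope ereal_scope.

Lemma lebesgue_measure_shift (a : R) (A : set R) : measurable A ->
  pushforward leb (fun x : measurableTypeR R => (x + a)%R : measurableTypeR R) A
  = leb A.
Proof.
move=> mA.
have mphi : measurable_fun setT
    (fun x : measurableTypeR R => (x + a)%R : measurableTypeR R).
  exact: measurable_funD.
pose phi : {mfun measurableTypeR R >-> measurableTypeR R} :=
  HB.pack (fun x : measurableTypeR R => (x + a)%R : measurableTypeR R)
    (isMeasurableFun.Build _ _ _ _ _ mphi).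
apply/esym; apply: (@lebesgue_measure_unique R (pushforward leb phi) _ A mA).
move=> _ [[x y]] _ <-.
transitivity (leb `](x - a)%R, (y - a)%R]%classic); last first.
  congr (leb _).
  by apply/seteqP; split => z /=; rewrite !in_itv/= ltrBlDr lerBrDr.
rewrite !lebesgue_measure_itv/= !lte_fin ltrD2r.
by case: ifP => // _; rewrite -EFinB; congr EFin; ring.
Qed.

Lemma ge0_integral_shift (a x y : R) f : measurable_fun [set: R] f ->
  (forall z, 0 <= f z) ->
  \int[leb]_(z in `[x, y]) f (z + a)%R = \int[leb]_(z in `[(x + a)%R, (y + a)%R]) f z.
Proof.
move=> mf f0.
have mphi : measurable_fun setT
    (fun x : measurableTypeR R => (x + a)%R : measurableTypeR R).
  exact: measurable_funD.
pose phi : {mfun measurableTypeR R >-> measurableTypeR R} :=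
  HB.pack (fun x : measurableTypeR R => (x + a)%R : measurableTypeR R)
    (isMeasurableFun.Build _ _ _ _ _ mphi).
transitivity (\int[pushforward leb phi]_(z in `[(x + a)%R, (y + a)%R]) f z).
  rewrite ge0_integral_pushforward//=; last exact: measurable_funS mf.
  congr (integral _ _ _).
  by apply/seteqP; split => z /=; rewrite !in_itv/= !lerD2r.
apply: eq_measure_integral => //= A mA _.
exact: lebesgue_measure_shift.
Qed.

Lemma ge0_integral_opp (x y : R) f : measurable_fun [set: R] f ->
  (forall z, 0 <= f z) ->
  \int[leb]_(z in `[x, y]) f (- z)%R = \int[leb]_(z in `[(- y)%R, (- x)%R]) f z.
Proof.
move=> mf f0.
transitivity (\int[pushforward leb (-%R : measurableTypeR R -> measurableTypeR R)]_(z in `[(- y)%R, (- x)%R]) f z).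
  rewrite ge0_integral_pushforward//=; last exact: measurable_funS mf.
  congr (integral _ _ _).
  by apply/seteqP; split => z /=; rewrite !in_itv/= !lerN2 andbC.
apply: eq_measure_integral => //= A mA _.
exact: lebesgue_measureN.
Qed.

Lemma ge0_integral_reflect (t x : R) f : measurable_fun [set: R] f ->
  (forall z, 0 <= f z) ->
  \int[leb]_(y in `[0%R, x]) f (t - y)%R = \int[leb]_(y in `[(t - x)%R, t]) f y.
Proof.
move=> mf f0.
under eq_integral do rewrite addrC.
rewrite (@ge0_integral_opp _ _ (fun z => f (z + t)%R))//; last first.
  exact: (measurableT_comp mf (measurable_funD _ _)).
by rewrite ge0_integral_shift// oppr0 add0r addrC.
Qed.

Lemma ge0_integral_itv_split (x y z : R) f : measurable_fun [set: R] f ->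
  (forall z, 0 <= f z) -> (x <= y)%R -> (y <= z)%R ->
  \int[leb]_(w in `[x, z]) f w =
  \int[leb]_(w in `[x, y]) f w + \int[leb]_(w in `[y, z]) f w.
Proof.
move=> mf f0 xy yz.
rewrite -[in RHS](@integral_itv_obnd_cbnd _ y); last exact: measurable_funS mf.
rewrite -ge0_integral_setU//.
- congr (integral _ _ _); apply/seteqP; split => w /=; rewrite !in_itv/=.
    move=> /andP[-> ->]; rewrite andbT.
    by case: leP => //=; [left|right].
  by move=> [|] /andP[h1 h2]; apply/andP; split; lra.
- exact: measurable_funS mf.
- apply/disj_set2P; rewrite -subset0 => w [] /=; rewrite !in_itv/=; lra.
Qed.

Lemma integral_itv_pow (n : nat) (x : R) : (0 <= x)%R ->
  \int[leb]_(y in `[0%R, x]) (y ^+ n)%:E = (x ^+ n.+1 / n.+1%:R)%:E.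
Proof.
move=> x0.
have [->|x1] := eqVneq x 0%R.
  by rewrite set_itv1 integral_set1 expr0n/= mul0r.
have n0 : (n.+1%:R != 0 :> R)%R by rewrite pnatr_eq0.
have cF (y : R) : (z ^+ n.+1 / n.+1%:R)%R @[z --> y] --> (y ^+ n.+1 / n.+1%:R)%R.
  by apply: cvgM; [exact: exprn_continuous|exact: cvg_cst].
have x_gt0 : (0 < x)%R by rewrite lt_neqAle eq_sym x1.
rewrite (@continuous_FTC2 _ _ (fun y => y ^+ n.+1 / n.+1%:R)%R)//=.
- by rewrite -EFinB expr0n/= mul0r subr0.
- by apply: continuous_subspaceT => y; exact: exprn_continuous.
- split.
  + by move=> y _; apply: derivableM => //; exact: exprn_derivable.
  + exact/cvg_at_right_filter/cF.
  + exact/cvg_at_left_filter/cF.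
- move=> y _; rewrite derive1Mr//; last exact: exprn_derivable.
  rewrite derive1E exp_derive.
  by rewrite /GRing.scale/=; field.
Qed.

Lemma integral_itv_norm (x : R) : (0 <= x)%R ->
  \int[leb]_(y in `[(- x)%R, 0%R]) `|y|%:E = (x ^+ 2 / 2)%:E.
Proof.
move=> x0; rewrite -[in LHS]oppr0 -ge0_integral_opp//; last first.
  by apply/measurable_EFinP; exact: normr_measurable.
rewrite -(integral_itv_pow 1)//; apply: eq_integral => y.
by rewrite inE/= in_itv/= => /andP[y0 _]; rewrite normrN ger0_norm.
Qed.

(** Tonelli on a product of two measurable domains, obtained by extending the
    integrand by zero. *)
Lemma fubini_tonelli_dom d1 d2 (T1 : measurableType d1) (T2 : measurableType d2)
  (m1 : {sigma_finite_measure set T1 -> \bar R})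
  (m2 : {sigma_finite_measure set T2 -> \bar R})
  (A : set T1) (B : set T2) (f : T1 -> T2 -> \bar R) :
  measurable A -> measurable B ->
  measurable_fun setT (fun z : T1 * T2 => f z.1 z.2) ->
  (forall x y, 0 <= f x y) ->
  \int[m1]_(x in A) \int[m2]_(y in B) f x y =
  \int[m2]_(y in B) \int[m1]_(x in A) f x y.
Proof.
move=> mA mB mf f0.
pose h (z : T1 * T2) := (fun z => f z.1 z.2) \_ (A `*` B) z.
have h0 z : 0 <= h z by rewrite /h /patch; case: ifP.
have mh : measurable_fun setT h.
  apply/(measurable_restrictT _ _).1; first exact: measurableX.
  exact: measurable_funS mf.
have := @fubini_tonelli _ _ _ _ _ m1 m2 h mh h0.
have e1 : \int[m1]_x \int[m2]_y h (x, y) = \int[m1]_(x in A) \int[m2]_(y in B) f x y.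
  rewrite [RHS]integral_mkcond; apply: eq_integral => x _.
  rewrite [RHS]/patch; case: ifPn => xA.
    rewrite [RHS]integral_mkcond; apply: eq_integral => y _.
    by rewrite /h /patch in_setX/= xA.
  by apply: integral0_eq => y _; rewrite /h /patch in_setX/= (negbTE xA).
have e2 : \int[m2]_y \int[m1]_x h (x, y) = \int[m2]_(y in B) \int[m1]_(x in A) f x y.
  rewrite [RHS]integral_mkcond; apply: eq_integral => y _.
  rewrite [RHS]/patch; case: ifPn => yB.
    rewrite [RHS]integral_mkcond; apply: eq_integral => x _.
    by rewrite /h /patch in_setX/= yB andbT.
  by apply: integral0_eq => x _; rewrite /h /patch in_setX/= (negbTE yB) andbF.
by rewrite e1 e2.
Qed.

Lemma measurable_integral_section d (T : measurableType d) (K : set (R * T))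
    (h : R * T -> \bar R) :
  measurable K -> measurable_fun setT h -> (forall z, 0 <= h z) ->
  measurable_fun setT (fun w => \int[leb]_(y in [set y | K (y, w)]) h (y, w)).
Proof.
move=> mK mh h0.
have mhK : measurable_fun setT (h \_ K).
  by apply/(measurable_restrictT _ _).1 => //; exact: measurable_funS mh.
have hK0 z : 0 <= (h \_ K) z by rewrite /patch; case: ifP.
have := @measurable_fun_fubini_tonelli_G _ _ _ _ R leb (h \_ K) mhK hK0.
rewrite (_ : fubini_G _ _ =
  fun w => \int[leb]_(y in [set y | K (y, w)]) h (y, w))//.
apply/funext => w; rewrite [RHS]integral_mkcond.
apply: eq_integral => y _; rewrite /patch.
by congr (if _ then _ else _); apply/idP/idP; rewrite !inE.
Qed.

Lemma measurable_window d (T : measurableType d) (X : T -> R) (g : R -> R)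
    (t : R) :
  measurable_fun [set: T] X -> measurable_fun [set: R] g ->
  (forall s, (0 <= g s)%R) ->
  measurable_fun [set: T] (fun w => \int[leb]_(y in `[0%R, X w]) (g (t - y))%:E).
Proof.
move=> mX mg g0.
pose K : set (R * T) := [set z | (0 <= z.1 <= X z.2)%R].
have mK : measurable K.
  rewrite (_ : K = (fun z => (0 <= z.1 <= X z.2)%R) @^-1` [set true]); last first.
    by apply/seteqP; split => z.
  rewrite -[X in measurable X]setTI.
  have : measurable_fun [set: R * T] (fun z => (0 <= z.1 <= X z.2)%R).
    apply: measurable_and; first exact: measurable_fun_ler.
    by apply: measurable_fun_ler => //; exact: (measurableT_comp mX).
  exact.
have mh : measurable_fun setT (fun z : R * T => (g (t - z.1))%:E).
  apply/measurable_EFinP; apply: (measurableT_comp mg).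
  exact: measurable_funB.
have := @measurable_integral_section _ T K (fun z => (g (t - z.1))%:E) mK mh.
have -> : (fun w => \int[leb]_(y in `[0%R, X w]) (g (t - y))%:E) =
  fun w => \int[leb]_(y in [set y | K (y, w)]) (g (t - y))%:E.
  by apply/funext => w; congr (integral _ _ _).
by apply => z; rewrite lee_fin.
Qed.

End lebesgue.
(** * The renewal function *)

Section renewal.
Context d (T : measurableType d) (R : realType) (mu : probability T R).
Variables (X : T -> R) (mX : measurable_fun [set: T] X).
Local Notation D := [set w | (0 < X w)%R].
Hypothesis muD : mu D = 1%E.
Local Open Scope ereal_scope.

(** The distribution function of the position after [n] steps of a random walk
    distributed like [X], by recursion on the first step. *)
Fixpoint walk_cdf (n : nat) : R -> \bar R :=
  if n is k.+1 then fun t => \int[mu]_(x in D) walk_cdf k (t - X x)%R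
  else fun t => (if (0 <= t)%R then 1 else 0).

Definition renewal (t : R) : \bar R := \sum_(n <oo) walk_cdf n t.

Lemma measurable_ge_level (a : R) : measurable [set w | (a <= X w)%R].
Proof.
rewrite (_ : [set w | _] = X @^-1` `[a, +oo[); first by rewrite -[X in measurable X]setTI; exact: mX.
by apply/seteqP; split => w /=; rewrite in_itv/= andbT.
Qed.

Lemma measurable_gt_level (a : R) : measurable [set w | (a < X w)%R].
Proof.
rewrite (_ : [set w | _] = X @^-1` `]a, +oo[); first by rewrite -[X in measurable X]setTI; exact: mX.
by apply/seteqP; split => w /=; rewrite in_itv/= andbT.
Qed.

Let mD : measurable D. Proof. exact: measurable_gt_level. Qed.

Let mXD : measurable_fun D X.
Proof. exact: (@measurable_funS _ _ _ _ setT). Qed.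

Lemma measurable_reflect (f : R -> \bar R) (t : R) :
  measurable_fun [set: R] f -> measurable_fun D (fun x => f (t - X x)%R).
Proof. by move=> mf; apply: (measurableT_comp mf); exact: measurable_funB. Qed.

Lemma walk_cdf_ge0 n t : 0 <= walk_cdf n t.
Proof.
elim: n t => [|n ih] t /=; first by case: ifP.
by apply: integral_ge0 => x _; exact: ih.
Qed.

Lemma walk_cdf_mono n : {homo walk_cdf n : x y / (x <= y)%R >-> x <= y}.
Proof.
elim: n => [|n ih] x y xy /=.
  case: ifPn => x0; last by case: ifP.
  by rewrite (le_trans x0 xy).
have mn : measurable_fun [set: R] (walk_cdf n) by exact: nondecreasing_emeasurable.
apply: ge0_le_integral => //.
- by move=> z _; exact: walk_cdf_ge0.
- exact: measurable_reflect.
- exact: measurable_reflect.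
- by move=> z _; apply: ih; rewrite lerD2r.
Qed.

Lemma measurable_walk_cdf n : measurable_fun [set: R] (walk_cdf n).
Proof. exact: nondecreasing_emeasurable (@walk_cdf_mono n). Qed.

Lemma walk_cdf_lt0 n (t : R) : (t < 0)%R -> walk_cdf n t = 0.
Proof.
elim: n t => [|n ih] t t0 /=; first by rewrite leNgt t0.
apply: integral0_eq => x x0; apply: ih.
by rewrite subr_lt0 (lt_trans t0).
Qed.

Lemma renewal_ge0 t : 0 <= renewal t.
Proof. by apply: nneseries_ge0 => n _ _; exact: walk_cdf_ge0. Qed.

Lemma renewal_mono : {homo renewal : x y / (x <= y)%R >-> x <= y}.
Proof.
move=> x y xy; apply: lee_nneseries => [n _ _|n _]; first exact: walk_cdf_ge0.
exact: walk_cdf_mono.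
Qed.

Lemma measurable_renewal : measurable_fun [set: R] renewal.
Proof. exact: nondecreasing_emeasurable renewal_mono. Qed.

Lemma renewal_lt0 (t : R) : (t < 0)%R -> renewal t = 0.
Proof. by move=> t0; apply: eseries0 => n _ _; exact: walk_cdf_lt0. Qed.

(** Conditioning on the first step. *)
Lemma renewal_equation t :
  renewal t = walk_cdf 0 t + \int[mu]_(x in D) renewal (t - X x)%R.
Proof.
rewrite /renewal nneseries_recl//; last by move=> n _; exact: walk_cdf_ge0.
congr (_ + _).
rewrite integral_nneseries//; last 2 first.
- by move=> n; apply: measurable_reflect; exact: measurable_walk_cdf.
- by move=> n x _; exact: walk_cdf_ge0.
rewrite -(@nneseries_addn _ _ 1)//; last by move=> n; exact: walk_cdf_ge0.
by apply: eq_eseriesr => n _; rewrite addn1.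
Qed.

(** Otherwise [0 < X] would be a countable union of the null sets
    [1 / (n + 1) <= X]. *)
Lemma step_far : exists2 a : R, (0 < a)%R & exists2 p : R, (0 < p)%R &
  mu [set x | (a <= X x)%R] = p%:E.
Proof.
pose F (n : nat) : set T := [set x | (n.+1%:R^-1 <= X x)%R].
have mF n : measurable (F n).
  exact: measurable_ge_level.
have UF : \bigcup_n F n = D.
  apply/seteqP; split => [x [n _ Fn]|x x0].
    rewrite /=; apply: lt_le_trans Fn.
    by rewrite invr_gt0 ltr0n.
  have /ltr_add_invr[k] : (0 < X x)%R := x0; rewrite add0r => kx.
  by exists k => //; exact: ltW.
have [[n hn]|h] := pselect (exists n, 0 < mu (F n)).
  exists n.+1%:R^-1%R; first by rewrite invr_gt0 ltr0n.
  have fin : mu (F n) \is a fin_num by exact: fin_num_measure.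
  exists (fine (mu (F n))); last by rewrite fineK.
  by rewrite -lte_fin fineK.
have : mu (\bigcup_n F n) = 0.
  apply: measure_negligible; first exact: bigcup_measurable.
  apply: negligible_bigcup => n; exists (F n); split => //.
  apply/eqP; rewrite -measure_le0 leNgt.
  by apply/negP => hn; apply: h; exists n.
by rewrite UF muD => /eqP; rewrite onee_eq0.
Qed.

Lemma measurable_expN : measurable_fun D (fun x => expR (- X x)).
Proof.
apply: (measurableT_comp (@measurable_expR R)).
exact: measurable_funN.
Qed.

(** Steps are positive, so their Laplace transform is below one; this makes
    the renewal function finite and bounds the mean excess from below. *)
Lemma laplace_lt1 : exists2 rho : R, (0 <= rho < 1)%R &
  \int[mu]_(x in D) (expR (- X x))%:E = rho%:E.
Proof.
have [a a0 [p p0 pE]] := step_far.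
have me := measurable_expN.
have ma : measurable [set x | (a <= X x)%R].
  exact: measurable_ge_level.
pose q : R := ((1 - expR (- a)))%R.
have q0 : (0 < q)%R by rewrite subr_gt0 expR_lt1 oppr_lt0.
have le1 : \int[mu]_(x in D) (expR (- X x) + q * \1_[set x | (a <= X x)%R] x)%:E <= 1.
  rewrite [leRHS](_ : 1 = \int[mu]_(x in D) 1%:E); last first.
    by rewrite realint_cst// mul1e; exact/esym/muD.
  apply: ge0_le_realint => //.
  - by apply: measurable_funD => //; apply: measurable_funM.
  - by move=> x _; rewrite addr_ge0 ?expR_ge0// mulr_ge0// ltW.
  - move=> x x0; rewrite indicE.
    have [ax|ax] := boolP (x \in _).
      rewrite mulr1 /q; move: ax; rewrite inE/= => ax.
      have : (expR (- X x) <= expR (- a))%R by rewrite ler_expR lerN2.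
      by lra.
    by rewrite mulr0 addr0 ltW// expR_lt1 oppr_lt0.
move: le1; rewrite ge0_realintD//; last 2 first.
- by apply: measurable_funM.
- by move=> x _; rewrite mulr_ge0// ltW.
rewrite ge0_realintZ//; last exact: ltW.
rewrite integral_indic//.
have -> : [set x | (a <= X x)%R] `&` D = [set x | (a <= X x)%R].
  apply/setIidPl => x /= ax.
  exact: lt_le_trans ax.
rewrite /= pE -EFinM => h.
have fin : \int[mu]_(x in D) (expR (- X x))%:E \is a fin_num.
  rewrite ge0_fin_numE; last first.
    by apply: integral_ge0 => x _; rewrite lee_fin expR_ge0.
  apply: le_lt_trans (ltry 1%R); apply: le_trans h.
  by rewrite leeDl// lee_fin mulr_ge0// ltW.
exists (fine (\int[mu]_(x in D) (expR (- X x))%:E)); last by rewrite fineK.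
rewrite fine_ge0/=; last by apply: integral_ge0 => x _; rewrite lee_fin expR_ge0.
move: h; rewrite -[X in X + _](fineK fin) -EFinD lee_fin.
by have := mulr_gt0 q0 p0; lra.
Qed.

Lemma renewal_fin t : renewal t \is a fin_num.
Proof.
have [rho /andP[rho0 rho1] rhoE] := laplace_lt1.
rewrite ge0_fin_numE ?renewal_ge0//.
apply: (@le_lt_trans _ _ ((1 - rho)^-1 * expR t)%:E); last exact: ltry.
rewrite /renewal; apply: lime_le.
  by apply: is_cvg_nneseries => n _ _; exact: walk_cdf_ge0.
apply: nearW => n.
have K0 : (0 < (1 - rho)^-1)%R by rewrite invr_gt0 subr_gt0.
elim: n t => [|n ih] t.
  by rewrite big_geq// lee_fin mulr_ge0 ?expR_ge0// ltW.
rewrite big_nat_recl//=.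
rewrite -(@ge0_integral_sum _ _ _ mu D mD _ (fun k x => walk_cdf k (t - X x)%R))//; last 2 first.
- by move=> k; apply: measurable_reflect; exact: measurable_walk_cdf.
- by move=> k x _; exact: walk_cdf_ge0.
have h0 : (if (0 <= t)%R then 1 else 0) <= (expR t)%:E :> \bar R.
  case: ifPn => t0; last by rewrite lee_fin expR_ge0.
  by rewrite lee_fin -expR0 ler_expR.
have h1 : \int[mu]_(x in D) \sum_(0 <= k < n) walk_cdf k (t - X x)%R <=
    ((1 - rho)^-1 * expR t * rho)%:E.
  rewrite EFinM -rhoE -ge0_realintZ//; last 2 first.
  - by rewrite mulr_ge0 ?expR_ge0// ltW.
  - exact: measurable_expN.
  apply: ge0_le_integral => //.
  - by move=> x _; apply: sume_ge0 => k _; exact: walk_cdf_ge0.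
  - by apply: emeasurable_sum => k; apply: measurable_reflect; exact: measurable_walk_cdf.
  - apply/measurable_EFinP; apply: measurable_funM => //.
    exact: measurable_expN.
  - move=> x _; apply: le_trans (ih _) _.
    by rewrite expRD mulrA.
apply: le_trans (leeD h0 h1) _.
rewrite -EFinD lee_fin le_eqVlt; apply/orP; left; apply/eqP.
by field; lra.
Qed.

End renewal.
(** * The mean excess over a level *)

Section mean_excess.
Context d (T : measurableType d) (R : realType) (mu : probability T R).
Variables (X : T -> R) (mX : measurable_fun [set: T] X).
Local Notation D := [set w | (0 < X w)%R].
Hypothesis muD : mu D = 1%E.
Variables m m2 : R.
Hypothesis XE : (\int[mu]_(w in D) (X w)%:E = m%:E)%E.
Hypothesis X2E : (\int[mu]_(w in D) (X w ^+ 2)%:E = m2%:E)%E.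
Local Notation leb := (@lebesgue_measure R).

(** By Wald's identity this is the mean of the overshoot of the level [t] by
    the random walk. *)
Definition excess (t : R) : R := m * fine (renewal mu X t) - t.

Let mD : measurable D. Proof. exact: measurable_gt_level. Qed.

Let mXD : measurable_fun D X.
Proof. exact: (@measurable_funS _ _ _ _ setT). Qed.

Let u t := fine (renewal mu X t).

Let uE t : (u t)%:E = renewal mu X t.
Proof. by rewrite fineK// renewal_fin. Qed.

Let u_ge0 t : 0 <= u t.
Proof. by rewrite fine_ge0// renewal_ge0. Qed.

Let u_mono s t : s <= t -> u s <= u t.
Proof. by move=> st; rewrite -lee_fin !uE renewal_mono. Qed.

Let mu_ : measurable_fun [set: R] u.
Proof. exact: nondecreasing_measurable. Qed.

Let comp_refl (f : R -> R) t : measurable_fun [set: R] f ->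
  measurable_fun D (fun w => f (t - X w)).
Proof. by move=> mf; apply: (measurableT_comp mf); exact: measurable_funB. Qed.

Lemma mean_gt0 : 0 < m.
Proof.
have [a a0 [p p0 pE]] := step_far mX muD.
have ma : measurable [set w | (a <= X w)%R] by exact: measurable_ge_level.
have : (\int[mu]_(w in D) (a * \1_[set w | (a <= X w)%R] w)%:E <= m%:E)%E.
  rewrite -XE; apply: ge0_le_realint => //.
  - exact: measurable_funM.
  - by move=> w _; rewrite mulr_ge0// ltW.
  - move=> w /= w0; rewrite indicE.
    have [|_] := boolP (w \in _); last by rewrite mulr0 ltW.
    by rewrite inE/= mulr1.
rewrite ge0_realintZ//; last exact: ltW.
rewrite integral_indic// (_ : _ `&` _ = [set w | (a <= X w)%R]); last first.
  by apply/setIidPl => w /= aw; exact: lt_le_trans aw.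
rewrite /= pE -EFinM lee_fin; apply: lt_le_trans.
exact: mulr_gt0.
Qed.

Lemma measurable_excess : measurable_fun [set: R] excess.
Proof. by apply: measurable_funB => //; exact: measurable_funM. Qed.

Lemma excess_lt0 (t : R) : t < 0 -> excess t = - t.
Proof. by move=> t0; rewrite /excess renewal_lt0// mulr0 sub0r. Qed.

Lemma excess_mono (s t : R) : s <= t -> excess s + s <= excess t + t.
Proof.
move=> st; rewrite /excess !subrK ler_pM2l ?mean_gt0//.
exact: u_mono.
Qed.

Lemma renewal_step (t : R) : 0 <= t ->
  (\int[mu]_(w in D) (u (t - X w))%:E = (u t - 1)%:E)%E.
Proof.
move=> t0.
have := renewal_equation mu mX t; rewrite /= t0 -uE => e.
under eq_integral do rewrite uE.
by rewrite EFinB e [X in (X - _)%E]addeC addeK.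
Qed.

(** If [excess] is at least [- rho ^ n * exp], then one step of the renewal
    equation improves the factor to [rho ^ n.+1], because [exp] is multiplied
    by [rho < 1] when averaged over a step. *)
Lemma excess_ge0 (t : R) : 0 <= excess t.
Proof.
have [rho /andP[rho0 rho1] rhoE] := laplace_lt1 mX muD.
have m0 := mean_gt0.
have H n s : - (rho ^+ n * expR s) <= excess s.
  elim: n s => [|n ih] s.
    rewrite mul1r /excess.
    have := expR_ge1Dx s; have := mulr_ge0 (ltW m0) (u_ge0 s); rewrite /u; lra.
  have [s0|s0] := ltP s 0.
    rewrite excess_lt0//; have := mulr_ge0 (exprn_ge0 n.+1 rho0) (expR_ge0 s).
    by lra.
  have c0 : 0 <= rho ^+ n * expR s by rewrite mulr_ge0 ?expR_ge0// exprn_ge0.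
  have me := @measurable_expN _ _ _ _ mX.
  have mf1 : measurable_fun D (fun w => m * u (s - X w)).
    by apply: measurable_funM => //; exact: comp_refl.
  have mf2 : measurable_fun D (fun w => rho ^+ n * expR s * expR (- X w)).
    exact: measurable_funM.
  have f10 w : 0 <= m * u (s - X w) by rewrite mulr_ge0// ltW.
  have f20 w : 0 <= rho ^+ n * expR s * expR (- X w) by rewrite mulr_ge0// expR_ge0.
  have : (\int[mu]_(w in D) s%:E <= \int[mu]_(w in D)
      (m * u (s - X w) + rho ^+ n * expR s * expR (- X w) + X w)%:E)%E.
    apply: ge0_le_realint => //.
    - by apply: measurable_funD => //; exact: measurable_funD.
    - move=> w /= w0; have := ih (s - X w).
      by rewrite /excess -/(u _) expRD mulrA; lra.
  rewrite realint_cst//= muD mule1.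
  rewrite ge0_realintD//; last 3 first.
  - exact: measurable_funD.
  - by move=> w _; rewrite addr_ge0.
  - by move=> w /= /ltW.
  rewrite ge0_realintD// !ge0_realintZ//; last 2 first.
  - exact: ltW.
  - exact: comp_refl.
  rewrite rhoE renewal_step// XE -!EFinM -!EFinD lee_fin.
  by rewrite /excess -/(u _) exprS; lra.
rewrite -(opprK (excess t)) oppr_ge0.
apply/ler_addgt0Pl => e e0; rewrite addr0.
have /cvgrPdist_lt/(_ (e / expR t)) : (rho ^+ n @[n --> \oo] --> (0 : R)).
  by apply: cvg_expr; rewrite ger0_norm.
rewrite divr_gt0 ?expR_gt0// => /(_ isT)[n _ /(_ n (leqnn n))/=].
rewrite sub0r normrN ger0_norm ?exprn_ge0// ltr_pdivlMr ?expR_gt0// => h.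
have := H n t; lra.
Qed.

(** A step lowers [m * renewal] by [m] on average, which is also the mean decrease
    of the level. *)
Lemma excess_harmonic (t : R) : 0 <= t ->
  (\int[mu]_(w in D) (excess (t - X w))%:E = (excess t)%:E)%E.
Proof.
move=> t0.
have mf : measurable_fun D (fun w => excess (t - X w)).
  by apply: comp_refl; exact: measurable_excess.
have e1 : (\int[mu]_(w in D) (excess (t - X w) + t)%:E =
          \int[mu]_(w in D) (m * u (t - X w) + X w)%:E)%E.
  by apply: eq_integral => w _; congr EFin; rewrite /excess -/(u _); ring.
have := @ge0_realintD _ _ _ mu D mD (fun w => excess (t - X w)) (cst t) mf
  (@measurable_cst _ _ _ _ _ _) (fun w _ => excess_ge0 _) (fun w _ => t0).
rewrite e1 ge0_realintD//; last 3 first.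
- by apply: measurable_funM => //; exact: comp_refl.
- by move=> w _; rewrite mulr_ge0// ltW// mean_gt0.
- by move=> w /= /ltW.
rewrite ge0_realintZ//; last 2 first.
- exact/ltW/mean_gt0.
- exact: comp_refl.
rewrite XE realint_cst//= muD mule1 renewal_step// -EFinM -EFinD => /esym e.
have : (\int[mu]_(w in D) (excess (t - X w))%:E)%E \is a fin_num.
  by move: e; case: (\int[mu]_(w in D) _)%E.
move=> /fineK; move: e => /[swap] <-; rewrite -EFinD => -[e].
by congr EFin; rewrite /excess -/(u t); lra.
Qed.

(** Conservation law: averaging the excess over a window of the length of an
    independent step gives the same value at every level.  Indeed
    [t - x, t] together with [- x, t - x] is [- x, 0] together with [0, t];
    the integral over [- x, t - x] averages, by harmonicity, to the integral
    over [0, t], and that over [- x, 0] is explicit. *)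
Lemma excess_conservation (t : R) : 0 <= t ->
  (\int[mu]_(w in D) \int[leb]_(y in `[0%R, X w]) (excess (t - y))%:E =
   (m2 / 2)%:E)%E.
Proof.
move=> t0.
pose g s := (excess s)%:E.
have mg : measurable_fun [set: R] g by apply/measurable_EFinP; exact: measurable_excess.
have g0 s : (0 <= g s)%E by rewrite lee_fin excess_ge0.
pose A := (\int[leb]_(y in `[0%R, t]) g y)%E.
have Afin : A \is a fin_num.
  rewrite ge0_fin_numE; last exact: integral_ge0.
  have h : (A <= \int[leb]_(y in `[0%R, t]) (m * u t)%:E)%E.
    apply: ge0_le_integral => //.
    - exact: measurable_funS mg.
    - move=> y; rewrite /= in_itv/= => /andP[y0 yt]; rewrite lee_fin /excess.
      have : m * u y <= m * u t by rewrite ler_pM2l ?mean_gt0// u_mono.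
      by rewrite /u; lra.
  apply: le_lt_trans h _.
  rewrite realint_cst//= lebesgue_measure_itv/=; case: ifP => _.
    by rewrite -EFinB -EFinM ltry.
  by rewrite mule0.
pose F w := (\int[leb]_(y in `[0%R, X w]) g (t - y)%R)%E.
pose G w := (\int[leb]_(y in `[0%R, t]) g (y - X w)%R)%E.
have FG w : D w -> (F w + G w = (2^-1 * X w ^+ 2)%:E + A)%E.
  move=> /= /ltW w0; rewrite /F /G ge0_integral_reflect//.
  rewrite (ge0_integral_shift (- X w))// sub0r addeC.
  rewrite -ge0_integral_itv_split//; [|lra|lra].
  rewrite (@ge0_integral_itv_split _ _ 0)//; last by rewrite oppr_le0.
  congr (_ + _)%E; rewrite mulrC -integral_itv_norm//.
  rewrite -[LHS]integral_itv_bndo_bndc; last exact: measurable_funS mg.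
  rewrite -[RHS]integral_itv_bndo_bndc; last first.
    by apply/measurable_EFinP; exact: measurable_funS (@normr_measurable R setT).
  apply: eq_integral => y.
  rewrite inE/= in_itv/= => /andP[_ y0]; rewrite /g excess_lt0//.
  by rewrite ltr0_norm.
have mk1 : measurable_fun setT (fun z : R * T => g (z.1 - X z.2)).
  apply: (measurableT_comp mg); apply: measurable_funB => //.
  exact: (measurableT_comp mX).
have mk2 : measurable_fun setT (fun z : R * T => g (t - z.1)).
  by apply: (measurableT_comp mg); exact: measurable_funB.
have GE : (\int[mu]_(w in D) G w = A)%E.
  rewrite /G -(@fubini_tonelli_dom R _ _ _ _ leb mu _ _ (fun y w => g (y - X w)))//.
  apply: eq_integral => y; rewrite inE/= in_itv/= => /andP[y0 _].
  exact: excess_harmonic.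
have mG : measurable_fun D G.
  apply: (@measurable_funS _ _ _ _ setT) => //.
  pose K : set (R * T) := `[0, t]%classic `*` setT.
  have := @measurable_integral_section _ _ T K (fun z => g (z.1 - X z.2)) _ mk1.
  rewrite (_ : (fun w => _) = G); last first.
    apply/funext => w; rewrite /G; congr (integral _ _ _).
    by apply/seteqP; split => y /=; [case|].
  by apply => //; exact: measurableX.
have mF : measurable_fun D F.
  apply: (@measurable_funS _ _ _ _ setT) => //.
  exact: (measurable_window t mX measurable_excess excess_ge0).
have : (\int[mu]_(w in D) (F w + G w) =
        \int[mu]_(w in D) ((2^-1 * X w ^+ 2)%:E + cst A w))%E.
  by apply: eq_integral => w /[!inE]; exact: FG.
have F0 w : (0 <= F w)%E by exact: integral_ge0.
have G0 w : (0 <= G w)%E by exact: integral_ge0.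
have A0 : (0 <= A)%E by exact: integral_ge0.
have mq : measurable_fun D (fun w => 2^-1 * X w ^+ 2).
  by apply: measurable_funM => //; exact: measurable_funX.
have q0 w : 0 <= 2^-1 * X w ^+ 2 by rewrite mulr_ge0// sqr_ge0.
rewrite (@ge0_integralD _ _ _ mu D mD F G)//.
rewrite (@ge0_integralD _ _ _ mu D mD (fun w => (2^-1 * X w ^+ 2)%:E))//; last 2 first.
- by move=> w _; rewrite lee_fin q0.
- exact/measurable_EFinP.
rewrite integral_cst//= muD mule1 GE ge0_realintZ//; last 2 first.
- exact: measurable_funX.
- by move=> w _; rewrite sqr_ge0.
rewrite X2E -EFinM => e.
rewrite -[LHS](addeK _ Afin) e addeK//; congr EFin; ring.
Qed.

End mean_excess.
(** * Steps that are not confined to a lattice *)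

Section lattice.
Context d (T : measurableType d) (R : realType) (mu : probability T R).
Variables (X : T -> R) (mX : measurable_fun [set: T] X).
Local Notation D := [set w | (0 < X w)%R].
Hypothesis muD : mu D = 1%E.

Definition step_near (x e : R) : set T := D `&` [set w | `|X w - x| < e].

(** The support of the law of a step. *)
Definition step_support (x : R) : Prop :=
  forall e : R, 0 < e -> (0 < mu (step_near x e))%E.

(** The levels that the walk can approach: sums of points of the support. *)
Inductive reachable : R -> Prop :=
| reachable0 : reachable 0
| reachableS x y : step_support x -> reachable y -> reachable (x + y).

Lemma measurable_step_near x e : measurable (step_near x e).
Proof.
apply: measurableI; first exact: measurable_gt_level.
have mh : measurable_fun setT (fun w => `|X w - x|).
  apply: measurableT_comp => //; exact: measurable_funB.
rewrite (_ : [set w | _] = (fun w => `|X w - x|) @^-1` `]-oo, e[).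
  by rewrite -[X in measurable X]setTI; exact: mh.
by apply/seteqP; split => w /=; rewrite in_itv.
Qed.

Lemma reachableD x y : reachable x -> reachable y -> reachable (x + y).
Proof.
move=> rx ry; elim: rx => [|a b sa _ ih]; first by rewrite add0r.
by rewrite -addrA; exact: reachableS.
Qed.

Lemma reachableMn x n : reachable x -> reachable (n%:R * x).
Proof.
move=> rx; elim: n => [|n ih]; first by rewrite mul0r; exact: reachable0.
by rewrite -natr1 mulrDl mul1r; exact: reachableD.
Qed.

Lemma support_reachable x : step_support x -> reachable x.
Proof. by move=> sx; rewrite -(addr0 x); apply: reachableS => //; exact: reachable0. Qed.

Lemma support_ge0 x : step_support x -> 0 <= x.
Proof.
move=> sx; rewrite leNgt; apply/negP => x0.
have /sx : 0 < - x by rewrite oppr_gt0.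
rewrite (_ : step_near x (- x) = set0) ?measure0 ?ltxx//.
rewrite -subset0 => w [/= w0]; rewrite ger0_norm; lra.
Qed.

(** The complement of the support is covered by the null balls with rational
    centre and radius, so a step lies in the support almost surely. *)
Lemma null_off_support (A : set T) : measurable A -> A `<=` D ->
  (forall w, A w -> ~ step_support (X w)) -> mu A = 0%E.
Proof.
move=> mA AD nA; apply: measure_negligible => //.
pose N (k : nat) : set T :=
  if unpickle k is Some (p, q) then
    if `[< mu (step_near (ratr p) (ratr q)) = 0%E >]
    then step_near (ratr p) (ratr q) else set0
  else set0.
apply: (@negligibleS _ _ _ _ (\bigcup_k N k)); last first.
  apply: negligible_bigcup => k; rewrite /N.
  case: unpickle => [[p q]|]; last exact: negligible_set0.
  case: asboolP => [h|_]; last exact: negligible_set0.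
  exists (step_near (ratr p) (ratr q)); split => //.
  exact: measurable_step_near.
move=> w Aw.
have /existsNP[e /not_implyP[e0 /negP]] := nA w Aw.
rewrite -leNgt measure_le0 => /eqP he.
have [p] := @rat_in_itvoo R (X w - e / 2) (X w + e / 2) ltac:(lra).
rewrite in_itv/= => /andP[p1 p2].
have [q] := @rat_in_itvoo R `|X w - ratr p| (e / 2) ltac:(by rewrite ltr_norml; lra).
rewrite in_itv/= => /andP[q1 q2].
have sub : step_near (ratr p) (ratr q) `<=` step_near (X w) e.
  move=> v [/= v0]; rewrite ltr_norml => h; split => //=.
  by move: q1; rewrite !ltr_norml; lra.
have [k kE] : exists k, unpickle k = Some (p, q).
  by exists (pickle (p, q)); exact: pickleK.
exists k; first exact: I.
rewrite /N kE.
case: asboolP => [_|[]]; first by split => //=; exact: AD.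
apply/eqP; rewrite -measure_le0 -he; apply: le_measure => //.
- by rewrite inE; exact: measurable_step_near.
- by rewrite inE; exact: measurable_step_near.
Qed.

Hypothesis nonlat : forall a : R, 0 < a ->
  mu [set w | exists n : nat, X w = n%:R * a] <> 1%E.

Lemma support_gt0 : exists2 c, step_support c & 0 < c.
Proof.
apply: contrapT => h.
have /eqP : mu D = 0%E.
  apply: null_off_support => //; first exact: measurable_gt_level.
  by move=> w w0 sw; apply: h; exists (X w).
by rewrite muD onee_eq0.
Qed.

(** Otherwise the differences of reachable levels would form a discrete
    subgroup, generated by its least positive element [g], and every step would
    be a multiple of [g]. *)
Lemma reachable_close (e : R) : 0 < e ->
  exists a b, [/\ reachable a, reachable b, 0 < a - b & a - b < e].
Proof.
move=> e0; apply: contrapT => no.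
pose G (x : R) := exists a b, [/\ reachable a, reachable b & x = a - b].
have GB x y : G x -> G y -> G (x - y).
  move=> [a [b [ra rb ->]]] [a' [b' [ra' rb' ->]]].
  exists (a + b'), (b + a'); split; [exact: reachableD..|ring].
have rG x : reachable x -> G x.
  by move=> rx; exists x, 0; split => //; [exact: reachable0|rewrite subr0].
have Ge x : G x -> 0 < x -> e <= x.
  move=> [a [b [ra rb ->]]] ab0; rewrite leNgt; apply/negP => abe.
  by apply: no; exists a, b.
pose P (n : nat) := `[< exists x, [/\ G x, 0 < x & Num.truncn (x / e) = n] >].
have exP : exists n, P n.
  have [c sc c0] := support_gt0.
  exists (Num.truncn (c / e)); apply/asboolP; exists c; split => //.
  exact/rG/support_reachable.
case: (ex_minnP exP) => n /asboolP[g [Gg g0 gn]] nmin.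
have Gmin x : G x -> 0 < x -> g <= x.
  move=> Gx x0; rewrite leNgt; apply/negP => xg.
  have nx : (n <= Num.truncn (x / e))%N by apply: nmin; apply/asboolP; exists x.
  have : e <= g - x by apply: Ge; [exact: GB|rewrite subr_gt0].
  have xe0 : 0 <= x / e by rewrite divr_ge0// ltW.
  have ge0 : 0 <= g / e by rewrite divr_ge0// ltW.
  have := truncn_itv xe0; have := truncn_itv ge0; rewrite gn.
  move=> /andP[_ gb] /andP[xb _].
  have : x / e < g / e + 0 by rewrite addr0 ltr_pM2r// invr_gt0.
  have nx' : n%:R <= x / e by apply: le_trans xb; rewrite ler_nat.
  have : (g - x) / e < 1.
    rewrite mulrBl; move: gb; rewrite -natr1; lra.
  by rewrite ltr_pdivrMr// mul1r; lra.
have supp x : step_support x -> exists n : nat, x = n%:R * g.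
  move=> sx; have x0 := support_ge0 sx.
  have Gn k : G (x - k%:R * g).
    elim: k => [|k ih]; first by rewrite mul0r subr0; exact/rG/support_reachable.
    by rewrite -natr1 mulrDl mul1r opprD addrA; exact: GB.
  exists (Num.truncn (x / g)).
  have xg0 : 0 <= x / g by rewrite divr_ge0// ltW.
  have /andP[h1 h2] := truncn_itv xg0.
  move: h1 h2; rewrite ler_pdivlMr// ltr_pdivrMr// -natr1 mulrDl mul1r => h1 h2.
  apply/eqP; rewrite -subr_eq0 eq_le; apply/andP; split; last by rewrite subr_ge0.
  rewrite leNgt; apply/negP => h3.
  have := Gmin _ (Gn (Num.truncn (x / g))) h3; lra.
apply: (nonlat g0).
pose L : set T := [set w | exists n : nat, X w = n%:R * g].
have mL : measurable L.
  rewrite (_ : L = X @^-1` (\bigcup_n [set n%:R * g])).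
    rewrite -[X in measurable X]setTI; apply: mX => //.
    by apply: bigcup_measurable => k _.
  by apply/seteqP; split => w /= [k]; [move=> h; exists k|move=> _ h; exists k].
have null : mu (D `\` L) = 0%E.
  apply: null_off_support.
  - by apply: measurableD => //; exact: measurable_gt_level.
  - by move=> w [].
  - by move=> w [_ nL] /supp.
have mD : measurable D by exact: measurable_gt_level.
apply/eqP; rewrite eq_le probability_le1//= -muD.
rewrite -(setDUK (@subIsetl _ D L)).
apply: le_trans (measureU2 _ _ _) _ => //.
- exact: measurableI.
- by apply: measurableD => //; exact: measurableI.
have -> : D `\` (D `&` L) = D `\` L by rewrite setDIr setDv set0U.
rewrite [X in (_ + X)%E]null adde0.
by apply: le_measure; rewrite ?inE//; exact: measurableI.
Qed.

(** With [d := a - b < e] the points [k * a + (n - k) * b = n * b + k * d] for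
    [k <= n] cover [n * b, n * b + n * d] up to [e], and these intervals overlap
    once [n * d >= b]. *)
Lemma reachable_dense (e : R) : 0 < e ->
  exists M : R, forall y, M <= y -> exists2 x, reachable x & y - e < x <= y.
Proof.
move=> e0.
have [a [b [ra rb ab0 abe]]] := reachable_close e0.
have [c sc c0] := support_gt0.
have rpos x : reachable x -> 0 <= x.
  by elim=> // {}x y /support_ge0 x0 _ y0; rewrite addr_ge0.
pose b' := b + c; pose g := a - b.
have rb' : reachable b' by apply: reachableD => //; exact: support_reachable.
have ra' : reachable (b' + g).
  rewrite (_ : b' + g = a + c); last by rewrite /b' /g; ring.
  by apply: reachableD => //; exact: support_reachable.
have b0 : 0 < b' by rewrite /b'; have := rpos _ rb; lra.
pose n0 := (Num.truncn (b' / g)).+1.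
exists (n0%:R * b') => y My.
have y0 : 0 <= y by apply: le_trans My; rewrite mulr_ge0// ltW.
have yb0 : 0 <= y / b' by rewrite divr_ge0// ltW.
have /andP[n1 n2] := truncn_itv yb0.
set n := Num.truncn (y / b') in n1 n2.
move: n1 n2; rewrite ler_pdivlMr// ltr_pdivrMr// -natr1 mulrDl mul1r => n1 n2.
have n0n : (n0 <= n)%N.
  by rewrite -ltnS -(@ltr_nat R) -(ltr_pM2r b0) -natr1 mulrDl mul1r; lra.
have r0 : 0 <= (y - n%:R * b') / g by apply: divr_ge0; [lra|exact: (ltW ab0)].
have /andP[k1 k2] := truncn_itv r0.
set k := Num.truncn ((y - n%:R * b') / g) in k1 k2.
move: k1 k2; rewrite ler_pdivlMr// ltr_pdivrMr// -natr1 mulrDl mul1r => k1 k2.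
have kn : (k <= n)%N.
  apply: leq_trans n0n.
  rewrite -(@ler_nat R); apply/ltW.
  apply: (@le_lt_trans _ _ (b' / g)); last exact: truncnS_gt.
  by rewrite ler_pdivlMr//; lra.
exists (k%:R * (b' + g) + (n - k)%:R * b').
  by apply: reachableD; exact: reachableMn.
by rewrite natrB//; rewrite -/g in abe; apply/andP; split; lra.
Qed.

End lattice.
(** * Convergence of harmonic functions *)

(** The upper limit is introduced by its characteristic properties, which are
    the only ones that the argument refers to. *)
Lemma limsup_exists (R : realType) (g : R -> R) (C : R) :
  (forall s, 0 <= g s) -> (forall s : R, 0 <= s -> g s <= C) ->
  exists L : R, [/\ 0 <= L,
    forall e : R, 0 < e -> exists2 s : R, 0 <= s & forall t : R, s <= t -> g t <= L + e &
    forall e s : R, 0 < e -> exists2 t : R, s <= t & L - e <= g t].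
Proof.
move=> g0 gC.
pose S : set R := [set l | exists2 s, 0 <= s & forall t, s <= t -> g t <= l].
have lbS : lbound S 0.
  by move=> l [s s0 /(_ s (lexx s))]; apply: le_trans; exact: g0.
have infS : has_inf S.
  by split; [exists C, 0 => // t t0; exact: gC|exists 0].
exists (inf S); split.
- by apply: lb_le_inf => //; exact: infS.1.
- move=> e e0; have [l [s s0 hs] le] := inf_adherent e0 infS.
  by exists s => // t st; apply: le_trans (hs t st) (ltW le).
- move=> e s e0; apply: contrapT => h.
  have : S (inf S - e).
    exists (Num.max s 0); first by rewrite le_max lexx orbT.
    move=> t; rewrite ge_max => /andP[st _].
    rewrite leNgt; apply/negP => lt; apply: h; exists t => //; exact: ltW.
  by move=> /(ge_inf infS.2); lra.
Qed.

Section harmonic_limit.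
Context d (T : measurableType d) (R : realType) (mu : probability T R).
Variables (X : T -> R) (mX : measurable_fun [set: T] X).
Local Notation D := [set w | (0 < X w)%R].
Hypothesis muD : mu D = 1%E.
Variables m m2 : R.
Hypothesis XE : (\int[mu]_(w in D) (X w)%:E = m%:E)%E.
Hypothesis X2E : (\int[mu]_(w in D) (X w ^+ 2)%:E = m2%:E)%E.
Local Notation leb := (@lebesgue_measure R).
Hypothesis nonlat : forall a : R, 0 < a ->
  mu [set w | exists n : nat, X w = n%:R * a] <> 1%E.

Variables (g : R -> R) (c : R).
Hypothesis mg : measurable_fun [set: R] g.
Hypothesis g_ge0 : forall t, 0 <= g t.
Hypothesis g_lt0 : forall t : R, t < 0 -> g t = - t.
Hypothesis g_mono : forall s t : R, s <= t -> g s + s <= g t + t.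
Hypothesis g_harm : forall t : R, 0 <= t ->
  (\int[mu]_(w in D) (g (t - X w))%:E = (g t)%:E)%E.
Hypothesis g_cons : forall t : R, 0 <= t ->
  (\int[mu]_(w in D) \int[leb]_(y in `[0%R, X w]) (g (t - y))%:E = (c * m)%:E)%E.

Let mD : measurable D. Proof. exact: measurable_gt_level. Qed.

Let mXD : measurable_fun D X.
Proof. exact: (@measurable_funS _ _ _ _ setT). Qed.

Let X_ge0 w : D w -> 0 <= X w. Proof. by move=> /= /ltW. Qed.

Let window t w := (\int[leb]_(y in `[0%R, X w]) (g (t - y))%:E)%E.

Let mwindow t : measurable_fun D (window t).
Proof.
apply: (@measurable_funS _ _ _ _ setT) => //.
exact: (measurable_window t mX mg g_ge0).
Qed.

Let window_ge0 t w : (0 <= window t w)%E.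
Proof. by apply: integral_ge0 => y _; rewrite lee_fin. Qed.

Let mgt t (A : set R) : measurable_fun A (fun y : R => (g (t - y))%:E).
Proof.
apply: measurable_funTS; apply/measurable_EFinP.
by apply: (measurableT_comp mg); exact: measurable_funB.
Qed.

Let leb_itv (x y : R) : x <= y -> leb `[x, y] = (y - x)%:E.
Proof.
move=> xy; rewrite lebesgue_measure_itv/= lte_fin; case: ltP => [_|yx].
  by rewrite EFinB.
by rewrite (le_anti (introT andP (conj xy yx))) subrr.
Qed.

Lemma window_lower (t : R) w (k x : R) : 0 <= k -> 0 <= x -> x <= X w ->
  (forall y : R, 0 <= y <= x -> k <= g (t - y)) -> ((k * x)%:E <= window t w)%E.
Proof.
move=> k0 x0 xX kg.
have -> : ((k * x)%:E = \int[leb]_(y in `[0%R, x]) k%:E)%E.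
  by rewrite realint_cst//= leb_itv// subr0 EFinM.
apply: (@le_trans _ _ (\int[leb]_(y in `[0%R, x]) (g (t - y))%:E)%E).
  by apply: ge0_le_integral => //; exact: mgt.
apply: ge0_subset_integral => //.
- exact: mgt.
- by move=> y _; rewrite lee_fin.
- by move=> y; rewrite /= !in_itv/= => /andP[-> yx]/=; exact: le_trans xX.
Qed.

Lemma segment_upper (t k x z : R) : x <= z ->
  (forall y : R, x <= y <= z -> g (t - y) <= k) ->
  (\int[leb]_(y in `[x, z]) (g (t - y))%:E <= (k * (z - x))%:E)%E.
Proof.
move=> xz gk.
have -> : ((k * (z - x))%:E = \int[leb]_(y in `[x, z]) k%:E)%E.
  by rewrite realint_cst//= leb_itv// EFinM.
apply: ge0_le_integral => //.
- by move=> y _; rewrite lee_fin.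
- exact: mgt.
Qed.

Let mean_pos : 0 < m. Proof. exact: (mean_gt0 mX muD XE). Qed.

(** A large value at [s] persists on [s, s + a], up to the decrease [a] that
    [g_mono] permits, and would make the window integral at [s + a] exceed the
    conserved value. *)
Lemma g_bounded : exists2 C : R, 0 < C & forall s : R, 0 <= s -> g s <= C.
Proof.
have [a a0 [p p0 pE]] := step_far mX muD.
have ma : measurable [set w | (a <= X w)%R] by exact: measurable_ge_level.
exists (`|a| + `|c * m| / (a * p) + 1).
  by have : 0 <= `|c * m| / (a * p) by [rewrite divr_ge0// mulr_ge0// ltW]; have := normr_ge0 a; lra.
move=> s s0; have t0 : 0 <= s + a by lra.
have [sa|sa] := leP (g s) a.
  apply: le_trans sa _; rewrite ger0_norm ?(ltW a0)//.
  by have : 0 <= `|c * m| / (a * p) by [rewrite divr_ge0// mulr_ge0// ltW]; lra.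
pose k := g s - a.
have k0 : 0 <= k by rewrite subr_ge0 ltW.
have h : (\int[mu]_(w in D) (k * a * \1_[set w | (a <= X w)%R] w)%:E <= (c * m)%:E)%E.
  rewrite -(g_cons t0); apply: ge0_le_integral => //.
  - by move=> w _; rewrite lee_fin !mulr_ge0// ltW.
  - by apply/measurable_EFinP; exact: measurable_funM.
  - exact: mwindow.
  - move=> w _; rewrite indicE; have [|_] := boolP (w \in _); last first.
      by rewrite mulr0; exact: window_ge0.
    rewrite inE/= mulr1 => aX; apply: window_lower => //; first exact: ltW.
    move=> y /andP[y0 ya]; have := @g_mono s (s + a - y); rewrite /k.
    by have -> : s <= s + a - y by [lra] => /(_ isT); lra.
move: h; rewrite ge0_realintZ//; last by rewrite mulr_ge0// ltW.
rewrite integral_indic// (_ : _ `&` _ = [set w | (a <= X w)%R]); last first.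
  by apply/setIidPl => w /= aw; exact: lt_le_trans aw.
rewrite /= pE -EFinM lee_fin => h.
have : k <= `|c * m| / (a * p).
  rewrite ler_pdivlMr ?mulr_gt0// mulrA; apply: le_trans h _; exact: ler_norm.
by rewrite /k; have := ler_norm a; lra.
Qed.

(** Once [g] is asymptotically at most [c], the conservation law leaves no room
    for low values: if [g t] were below [c] by [e], then so would be [g] just
    to the left of [t], by half as much, and the average over the window would
    be too small. *)
Lemma liminf_ge :
  (forall e : R, 0 < e ->
    exists2 s : R, 0 <= s & forall t : R, s <= t -> g t <= c + e) ->
  forall e : R, 0 < e ->
    exists2 s : R, 0 <= s & forall t : R, s <= t -> c - e <= g t.
Proof.
move=> c_upper e e0; have m0 := mean_pos.
have [C C0 gC] := g_bounded.
have [a a0 [p p0 pE]] := step_far mX muD.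
have ma : measurable [set w | (a <= X w)%R] by exact: measurable_ge_level.
have [x0 [x00 x0a x0e]] : exists x0 : R, [/\ 0 < x0, x0 <= a & x0 <= e / 2].
  exists (Num.min a (e / 2)); split.
  - by rewrite lt_min a0 divr_gt0.
  - by rewrite ge_min lexx.
  - by rewrite ge_min lexx orbT.
have [eta eta0 etaE] : exists2 eta : R, 0 < eta & eta * (m + 1) = e / 4 * x0 * p.
  have m1 : 0 < m + 1 by lra.
  exists (e / 4 * x0 * p / (m + 1)); last by rewrite divfK// gt_eqF.
  by rewrite divr_gt0// !mulr_gt0// divr_gt0.
have [s1 s10 hs1] := c_upper _ eta0.
have mf : measurable_fun D (fun w => C * X w + X w ^+ 2).
  by apply: measurable_funD; [exact: measurable_funM|exact: measurable_funX].
have f0 w : D w -> 0 <= C * X w + X w ^+ 2.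
  by move=> Dw; rewrite addr_ge0 ?sqr_ge0// mulr_ge0 ?X_ge0// ltW.
have fi : (\int[mu]_(w in D) (C * X w + X w ^+ 2)%:E < +oo)%E.
  rewrite ge0_realintD//.
  - by rewrite ge0_realintZ ?(ltW C0)// XE X2E -EFinM -EFinD ltry.
  - exact: measurable_funM.
  - exact: measurable_funX.
  - by move=> w Dw; rewrite mulr_ge0 ?X_ge0// ltW.
  - by move=> w _; exact: sqr_ge0.
have [W W0 hW] := realint_tail mD mXD mf f0 fi eta0.
exists (s1 + W) => [|t st]; first lra.
rewrite leNgt; apply/negP => gt.
have gt0 := g_ge0 t.
pose tail w := if W < X w then C * X w + X w ^+ 2 else 0.
have mtail : measurable_fun D tail.
  apply: measurable_fun_if => //; first exact: measurable_fun_ltr.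
  by apply: measurable_funS mf => // w [].
have tail0 w : D w -> 0 <= tail w.
  by move=> Dw; rewrite /tail; case: ifP => // _; exact: f0.
have gap0 w : 0 <= e / 2 * x0 * \1_[set w | (a <= X w)%R] w.
  by rewrite !mulr_ge0// ?ltW// divr_gt0.
have indE w : \1_[set w | (a <= X w)%R] w = (a <= X w)%R%:R :> R.
  by rewrite indicE; congr (nat_of_bool _)%:R; apply/idP/idP; rewrite inE.
have near_t (y : R) : 0 <= y <= x0 -> g (t - y) <= c - e / 2.
  move=> /andP[y0 yx]; have := @g_mono (t - y) t.
  by have -> : t - y <= t by [lra] => /(_ isT); lra.
have bound w : D w ->
    (window t w + (e / 2 * x0 * \1_[set w | (a <= X w)%R] w)%:E <=
     ((c + eta) * X w + tail w)%:E)%E.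
  move=> Dw; have X0 := X_ge0 Dw.
  rewrite /tail indE; case: ltP => WX.
    have h : (window t w <= ((C + X w) * (X w - 0))%:E)%E.
      apply: segment_upper => // y /andP[y0 yX].
      have [ty|ty] := ltP (t - y) 0; first by rewrite g_lt0//; lra.
      by have := gC _ ty; lra.
    apply: le_trans (leeD2r _ h) _; rewrite -EFinD lee_fin.
    case: (leP a (X w)) => aX; rewrite ?mulr1 ?mulr0.
      have : e / 2 * x0 <= c * X w by apply: ler_pM; lra.
      by have := mulr_ge0 (ltW eta0) X0; rewrite expr2; lra.
    have : 0 <= (c + eta) * X w by rewrite mulr_ge0//; lra.
    by rewrite expr2; lra.
  have far (y : R) : 0 <= y <= X w -> g (t - y) <= c + eta.
    by move=> /andP[y0 yX]; apply: hs1; lra.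
  rewrite addr0; case: (leP a (X w)) => aX; rewrite ?mulr1 ?mulr0.
    have -> : window t w = (\int[leb]_(y in `[0%R, x0]) (g (t - y))%:E +
        \int[leb]_(y in `[x0, X w]) (g (t - y))%:E)%E.
      apply: ge0_integral_itv_split; [exact: mgt| |exact: ltW|lra].
      by move=> y; rewrite lee_fin.
    have h1 : (\int[leb]_(y in `[0%R, x0]) (g (t - y))%:E <= ((c - e / 2) * (x0 - 0))%:E)%E.
      by apply: segment_upper; first exact: ltW.
    have h2 : (\int[leb]_(y in `[x0, X w]) (g (t - y))%:E <= ((c + eta) * (X w - x0))%:E)%E.
      by apply: segment_upper => [|y /andP[y0 yX]]; [lra|apply: far; apply/andP; lra].
    apply: le_trans (leeD2r _ (leeD h1 h2)) _; rewrite -!EFinD lee_fin.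
    by have := mulr_gt0 eta0 x00; lra.
  rewrite adde0; have := segment_upper X0 far; rewrite subr0; exact.
have h : (\int[mu]_(w in D) (window t w + (e / 2 * x0 * \1_[set w | (a <= X w)%R] w)%:E) <=
    \int[mu]_(w in D) ((c + eta) * X w + tail w)%:E)%E.
  apply: ge0_le_integral => //.
  - by move=> w _; rewrite adde_ge0// lee_fin.
  - apply: emeasurable_funD; first exact: mwindow.
    by apply/measurable_EFinP; exact: measurable_funM.
  - by apply/measurable_EFinP; apply: measurable_funD => //; exact: measurable_funM.
move: h; rewrite (@ge0_integralD _ _ _ mu D mD (window t))//; last 2 first.
- by move=> w _; rewrite lee_fin.
- by apply/measurable_EFinP; exact: measurable_funM.
have c0 : 0 <= c + eta by lra.
rewrite g_cons; last lra.
rewrite (@ge0_realintZ _ _ _ mu D mD (e / 2 * x0))//; last first.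
  by rewrite mulr_ge0// ?ltW// divr_gt0.
rewrite integral_indic// (_ : _ `&` _ = [set w | (a <= X w)%R]); last first.
  by apply/setIidPl => w /= aw; exact: lt_le_trans aw.
rewrite ge0_realintD//; last 2 first.
- exact: measurable_funM.
- by move=> w Dw; rewrite mulr_ge0// X_ge0.
rewrite ge0_realintZ// XE /= pE -!EFinM -EFinD => h.
have := le_trans h (leeD (lexx _) hW); rewrite -EFinD lee_fin.
by have := mulr_gt0 (mulr_gt0 e0 x00) p0; lra.
Qed.

Variable L : R.
Hypothesis L_ge0 : 0 <= L.
Hypothesis L_upper : forall e : R, 0 < e ->
  exists2 s : R, 0 <= s & forall t : R, s <= t -> g t <= L + e.

(** If [g] is nearly maximal at [t], then by harmonicity it must be nearly
    maximal at [t - y] for some [y] near any given point of the support. *)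
Lemma maximum_spreads_support (x e : R) : step_support mu X x -> 0 < e ->
  exists2 del : R, 0 < del & exists s : R, forall t : R, s <= t -> L - del <= g t ->
  exists2 y : R, `|y - x| < e & L - e <= g (t - y).
Proof.
move=> sx e0; have L0 := L_ge0.
have [C C0 gC] := g_bounded.
have := sx _ e0; set B := step_near X x e => muB.
have mB : measurable B by exact: measurable_step_near.
have [p pE] : exists p : R, mu B = p%:E.
  by exists (fine (mu B)); rewrite fineK// fin_num_measure.
have p0 : 0 < p by rewrite -lte_fin -pE.
have [eta eta0 etaE] : exists2 eta : R, 0 < eta & eta * 4 = p * e.
  by exists (p * e / 4); [rewrite divr_gt0// mulr_gt0|field].
have [s1 s10 hs1] := L_upper eta0.
have mf : measurable_fun D (fun w => C + X w) by exact: measurable_funD.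
have f0 w : D w -> 0 <= C + X w by move=> /X_ge0; lra.
have fi : (\int[mu]_(w in D) (C + X w)%:E < +oo)%E.
  rewrite ge0_realintD//; last by move=> w _; exact: ltW.
  by rewrite XE realint_cst//= muD mule1 -EFinD ltry.
have [W W0 hW] := realint_tail mD mXD mf f0 fi eta0.
exists eta => //; exists (s1 + W) => t st Lt.
apply: contrapT => no.
have small y : `|y - x| < e -> g (t - y) < L - e.
  by move=> ye; rewrite ltNge; apply/negP => h; apply: no; exists y.
have t0 : 0 <= t by lra.
pose tail w := if W < X w then C + X w else 0.
have mtail : measurable_fun D tail.
  apply: measurable_fun_if => //; first exact: measurable_fun_ltr.
  by apply: measurable_funS mf => // w [].
have tail0 w : D w -> 0 <= tail w.
  by move=> Dw; rewrite /tail; case: ifP => // _; exact: f0.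
have mgX : measurable_fun D (fun w => g (t - X w)).
  by apply: (measurableT_comp mg); exact: measurable_funB.
have : (\int[mu]_(w in D) (g (t - X w) + e * \1_B w)%:E <=
        \int[mu]_(w in D) (L + eta + tail w)%:E)%E.
  apply: ge0_le_realint => //.
  - by apply: measurable_funD => //; exact: measurable_funM.
  - exact: measurable_funD.
  - by move=> w _; rewrite addr_ge0// mulr_ge0// ltW.
  - move=> w Dw; have X0 := X_ge0 Dw; have tw := tail0 w Dw.
    have gle : g (t - X w) <= L + eta + tail w.
      rewrite /tail; case: ltP => WX; last first.
        by rewrite addr0; apply: hs1; lra.
      have [tX|tX] := ltP (t - X w) 0; first by rewrite g_lt0//; lra.
      by have := gC _ tX; lra.
    rewrite indicE; have [|_] := boolP (w \in B); last by rewrite mulr0 addr0.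
    rewrite inE => -[_ /= /small/ltW hs]; rewrite mulr1 -lerBrDr.
    by apply: le_trans hs _; rewrite lerD2r -addrA lerDl addr_ge0// ltW.
rewrite ge0_realintD//; last 2 first.
- exact: measurable_funM.
- by move=> w _; rewrite mulr_ge0// ltW.
rewrite g_harm// ge0_realintZ//; last exact: ltW.
rewrite integral_indic// setIidl; last by move=> w [].
rewrite /= pE ge0_realintD//; last by move=> w _; lra.
rewrite realint_cst//= muD mule1 -EFinM -EFinD => h.
have := le_trans h (leeD (lexx _) hW); rewrite -EFinD lee_fin.
by lra.
Qed.

(** Iterating along the points of the support that sum up to [x]; the precision
    at each stage is the one that the next stage asks for. *)
Lemma maximum_spreads (x : R) : reachable mu X x -> forall e : R, 0 < e ->
  exists2 del : R, 0 < del & exists s : R, forall t : R, s <= t -> L - del <= g t ->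
  exists2 y : R, `|y - x| < e & L - e <= g (t - y).
Proof.
elim=> [|{}x z sx _ ih] e e0.
  exists e => //; exists 0 => t _ h; exists 0; first by rewrite subrr normr0.
  by rewrite subr0.
have e20 : 0 < e / 2 by lra.
have [d1 d10 [s1 h1]] := maximum_spreads_support sx e20.
have e'0 : 0 < Num.min (e / 2) d1 by rewrite lt_min e20.
have [d2 d20 [s2 h2]] := ih _ e'0.
exists d2 => //; exists (Num.max s2 (s1 + z + e)) => t.
rewrite ge_max => /andP[st1 st2] /(h2 _ st1)[y2].
rewrite lt_min ltr_norml => /andP[y2e _] gy2.
have min1 : Num.min (e / 2) d1 <= d1 by rewrite ge_min lexx orbT.
have /h1 : s1 <= t - y2 by lra.
move=> /(_ _)[|y1 y1e gy1]; first lra.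
exists (y1 + y2); last first.
  by rewrite (_ : t - (y1 + y2) = t - y2 - y1); [lra|ring].
move: y1e; rewrite !ltr_norml => /andP[y11 y12]; move: y2e => /andP[y21 y22].
by apply/andP; split; lra.
Qed.

Lemma maximum_spreads_seq (xs : seq R) : (forall x, x \in xs -> reachable mu X x) ->
  forall e : R, 0 < e ->
  exists2 del : R, 0 < del & exists s : R, forall t : R, s <= t -> L - del <= g t ->
  forall x, x \in xs -> exists2 y : R, `|y - x| < e & L - e <= g (t - y).
Proof.
move=> rxs e e0; elim: xs rxs => [|x xs ih] rxs; first by exists 1 => //; exists 0.
have [|d1 d10 [s1 h1]] := ih; first by move=> y yxs; apply: rxs; rewrite inE yxs orbT.
have [|d2 d20 [s2 h2]] := @maximum_spreads x _ e e0; first by apply: rxs; rewrite mem_head.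
exists (Num.min d1 d2); first by rewrite lt_min d10.
exists (Num.max s1 s2) => t; rewrite ge_max => /andP[st1 st2] Lt y.
have Lt1 : L - d1 <= g t by apply: le_trans Lt; rewrite lerB// ge_min lexx.
have Lt2 : L - d2 <= g t by apply: le_trans Lt; rewrite lerB// ge_min lexx orbT.
by rewrite inE => /predU1P[->|]; [exact: h2|exact: h1].
Qed.

Hypothesis L_lower : forall e s : R, 0 < e -> exists2 t : R, s <= t & L - e <= g t.

(** Reachable levels being dense far out, [g] is nearly maximal along a whole
    window; between the reached points [g] can only be larger, up to the
    mesh, because [g t + t] is nondecreasing. *)
Lemma maximum_window (W e : R) : 0 < W -> 0 < e ->
  exists2 t : R, W <= t & forall z : R, 0 <= z <= W -> L - e <= g (t - z).
Proof.
move=> W0 e0.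
have [h h0 h5] : exists2 h : R, 0 < h & h * 5 = e.
  by exists (e / 5); [rewrite divr_gt0|field].
have [M hM] := reachable_dense mX muD nonlat h0.
pose q (k : nat) : R := `|M| + k%:R * h.
have qM k : M <= q k.
  by apply: le_trans (ler_norm M) _; rewrite lerDl mulr_ge0// ltW.
have /boolp.choice[x hx] : forall k, exists y : R,
    reachable mu X y /\ q k - h < y <= q k.
  by move=> k; have [y ry hy] := hM _ (qM k); exists y.
pose N := (Num.truncn (W / h)).+4.
have [|del del0 [s hs]] := @maximum_spreads_seq [seq x k | k <- iota 0 N] _ h h0.
  by move=> y /mapP[k _ ->]; have [] := hx k.
have [t' st' Lt'] := L_lower (Num.max s (`|M| + W)) del0.
move: st'; rewrite ge_max => /andP[st' Mt'].
exists (t' - `|M|); first lra.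
move=> z /andP[z0 zW].
have zh0 : 0 <= z / h by rewrite divr_ge0// ltW.
have /andP[k1 k2] := truncn_itv zh0.
set k := Num.truncn (z / h) in k1 k2.
move: k1 k2; rewrite ler_pdivlMr// ltr_pdivrMr// -natr1 mulrDl mul1r => k1 k2.
have kN : (k < (Num.truncn (W / h)).+1)%N.
  by rewrite ltnS /k; apply: le_truncn; rewrite ler_pM2r// invr_gt0.
have [|y yx gy] := hs _ st' Lt' (x k.+3).
  by apply: map_f; rewrite mem_iota/= add0n; exact: kN.
have [_] := hx k.+3; rewrite /q => /andP[x1 x2].
have e3 : k.+3%:R * h = k%:R * h + 3 * h by rewrite -addn3 natrD; ring.
move: yx x1 x2; rewrite e3 ltr_norml => yx x1 x2.
have := @g_mono (t' - y) (t' - `|M| - z).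
have -> : t' - y <= t' - `|M| - z by lra.
by move=> /(_ isT); lra.
Qed.

(** On a window of length [W] where [g] is nearly [L], the window integral is at
    least nearly [L * min (X, W)], whose mean is nearly [L * m]. *)
Lemma limsup_le : L <= c.
Proof.
have m0 := mean_pos; have L0' := L_ge0.
rewrite leNgt; apply/negP => cL.
have c0 : 0 <= c.
  have : (0 <= (c * m)%:E)%E.
    by rewrite -(g_cons (lexx 0)); apply: integral_ge0 => w _; exact: window_ge0.
  by rewrite lee_fin pmulr_lge0.
have L0 : 0 < L by lra.
have [e [e0 e1 e2]] : exists e : R,
    [/\ 0 < e, e <= (L - c) / 2 & e * (4 * L) <= m * (L - c)].
  exists (Num.min ((L - c) / 2) (m * (L - c) / (4 * L))); split.
  - by rewrite lt_min !divr_gt0 ?mulr_gt0//; lra.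
  - by rewrite ge_min lexx.
  - by rewrite -ler_pdivlMr ?mulr_gt0// ge_min lexx orbT.
have Xi : (\int[mu]_(w in D) (X w)%:E < +oo)%E by rewrite XE ltry.
have [W W0 hW] := realint_tail mD mXD mXD X_ge0 Xi e0.
have [t Wt ht] := maximum_window W0 e0.
pose tail w := if W < X w then X w else 0.
have mtail : measurable_fun D tail.
  apply: measurable_fun_if => //; first exact: measurable_fun_ltr.
  by apply: measurable_funS mXD => // w [].
have tail0 w : D w -> 0 <= tail w.
  by move=> Dw; rewrite /tail; case: ifP => // _; exact: X_ge0.
pose k := L - e; have k0 : 0 <= k by rewrite /k; lra.
have mmin : measurable_fun D (fun w => Num.min (X w) W).
  exact: measurable_minr.
have min0 w : D w -> 0 <= Num.min (X w) W.
  by move=> Dw; rewrite le_min X_ge0//= ltW.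
have h1 : (\int[mu]_(w in D) (k * Num.min (X w) W)%:E <= (c * m)%:E)%E.
  have t0 : 0 <= t by lra.
  rewrite -(g_cons t0); apply: ge0_le_integral => //.
  - by move=> w Dw; rewrite lee_fin mulr_ge0// min0.
  - by apply/measurable_EFinP; exact: measurable_funM.
  - exact: mwindow.
  - move=> w Dw; apply: window_lower => //; first exact: min0.
      by rewrite ge_min lexx.
    move=> y /andP[y0]; rewrite le_min => /andP[_ yW].
    by apply: ht; rewrite y0.
have h2 : (m%:E <= \int[mu]_(w in D) (Num.min (X w) W + tail w)%:E)%E.
  rewrite -XE; apply: ge0_le_realint => //.
  - exact: measurable_funD.
  - move=> w Dw; rewrite /tail; case: ltP => WX.
      by rewrite lerDr ltW.
    by rewrite addr0.
move: h2; rewrite ge0_realintD// => h2.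
have := le_trans h2 (leeD (lexx _) hW).
move: h1; rewrite ge0_realintZ//.
have : (0 <= \int[mu]_(w in D) (Num.min (X w) W)%:E)%E.
  by apply: integral_ge0 => w Dw; rewrite lee_fin min0.
have : (\int[mu]_(w in D) (Num.min (X w) W)%:E < +oo)%E.
  apply: le_lt_trans Xi; apply: ge0_le_realint => // w _.
  by rewrite ge_min lexx.
case: (\int[mu]_(w in D) (Num.min (X w) W)%:E)%E => // r _ r0.
rewrite -EFinM -EFinD !lee_fin => h3 h4.
rewrite lee_fin in r0.
have : k * (m - e) <= c * m by apply: le_trans h3; apply: ler_wpM2l => //; lra.
have em : e * m <= (L - c) / 2 * m by rewrite ler_wpM2r// ltW.
have := mulr_gt0 e0 e0; have : 0 < (L - c) * m by rewrite mulr_gt0//; lra.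
by rewrite /k; nra.
Qed.

End harmonic_limit.

Section renewal_second_order.
Context d (T : measurableType d) (R : realType) (mu : probability T R).
Variables (X : T -> R) (mX : measurable_fun [set: T] X).
Local Notation D := [set w | (0 < X w)%R].
Hypothesis muD : mu D = 1%E.
Variables m m2 : R.
Hypothesis XE : (\int[mu]_(w in D) (X w)%:E = m%:E)%E.
Hypothesis X2E : (\int[mu]_(w in D) (X w ^+ 2)%:E = m2%:E)%E.
Hypothesis nonlat : forall a : R, 0 < a ->
  mu [set w | exists n : nat, X w = n%:R * a] <> 1%E.

Theorem excess_cvg (e : R) : 0 < e ->
  exists2 s : R, 0 <= s & forall t : R, s <= t ->
    `|excess mu X m t - m2 / (2 * m)| <= e.
Proof.
have m0 := mean_gt0 mX muD XE.
have mg := measurable_excess mX muD m.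
have g0 := excess_ge0 mX muD XE.
have gl := excess_lt0 mu X m.
have gm := excess_mono mX muD XE.
have gh := excess_harmonic mX muD XE.
have gc (t : R) : 0 <= t -> (\int[mu]_(w in D) \int[lebesgue_measure]_(y in `[0%R, X w])
    (excess mu X m (t - y))%:E = (m2 / (2 * m) * m)%:E)%E.
  move=> t0; rewrite (excess_conservation mX muD XE X2E t0); congr EFin.
  by field; rewrite gt_eqF.
have [C C0 gC] := g_bounded mX muD mg g0 gm gc.
have [L [L0 Lup Llow]] := limsup_exists g0 gC.
have Lc := limsup_le mX muD XE nonlat mg g0 gl gm gh gc L0 Lup Llow.
have cup (h : R) : 0 < h -> exists2 s : R, 0 <= s & forall t : R, s <= t ->
    excess mu X m t <= m2 / (2 * m) + h.
  move=> h0; have [s s0 hs] := Lup h h0; exists s => // t /hs gt.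
  by apply: le_trans gt _; rewrite lerD2r.
move=> e0.
have [s s0 hs] := cup e e0.
have [s' s0' hs'] := liminf_ge mX muD XE X2E mg g0 gl gm gc cup e0.
exists (Num.max s s'); first by rewrite le_max s0.
move=> t; rewrite ge_max => /andP[/hs h1 /hs' h2].
by rewrite ler_norml lerBrDr lerBlDr addrC h2 addrC h1.
Qed.

End renewal_second_order.
(** * Delayed renewal functions *)

Section delayed.
Context d (T : measurableType d) (R : realType) (mu : probability T R).
Variables (X Y : T -> R).
Hypotheses (mX : measurable_fun [set: T] X) (mY : measurable_fun [set: T] Y).
Hypothesis muX : mu [set w | (0 < X w)%R] = 1%E.
Local Notation D := [set w | (0 < Y w)%R].
Hypothesis muY : mu D = 1%E.

(** The expected number of points in [0, t] of a walk with steps distributed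
    like [X], all points being shifted independently by copies of [Y]. *)
Definition delayed_renewal (t : R) : \bar R :=
  (\int[mu]_(w in D) renewal mu X (t - Y w))%E.

Let mD : measurable D. Proof. exact: measurable_gt_level. Qed.

Let mYD : measurable_fun D Y.
Proof. exact: (@measurable_funS _ _ _ _ setT). Qed.

Let comp_refl (f : R -> R) t : measurable_fun [set: R] f ->
  measurable_fun D (fun w => f (t - Y w)).
Proof. by move=> mf; apply: (measurableT_comp mf); exact: measurable_funB. Qed.

Let mren t : measurable_fun D (fun w => renewal mu X (t - Y w)).
Proof.
apply: (measurableT_comp (measurable_renewal mu mX)).
exact: measurable_funB.
Qed.

Lemma delayed_renewal_ge0 t : (0 <= delayed_renewal t)%E.
Proof. by apply: integral_ge0 => w _; exact: renewal_ge0. Qed.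

Lemma delayed_renewal_mono :
  {homo delayed_renewal : x y / x <= y >-> (x <= y)%E}.
Proof.
move=> s t st; apply: ge0_le_integral => //.
- by move=> w _; exact: renewal_ge0.
- by move=> w _; apply: renewal_mono => //; rewrite lerD2r.
Qed.

Lemma delayed_renewal_lt0 (t : R) : t < 0 -> delayed_renewal t = 0%E.
Proof.
move=> t0; apply: integral0_eq => w /= w0; apply: renewal_lt0.
by rewrite subr_lt0 (lt_trans t0).
Qed.

Lemma delayed_renewal_fin t : delayed_renewal t \is a fin_num.
Proof.
rewrite ge0_fin_numE ?delayed_renewal_ge0//.
apply: (@le_lt_trans _ _ (renewal mu X t)).
  rewrite -[leRHS]mule1 -muY -integral_cst//; apply: ge0_le_integral => //.
  - by move=> w _; exact: renewal_ge0.
  - by move=> w /= w0; apply: renewal_mono => //; rewrite lerBlDr lerDl ltW.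
by rewrite -ge0_fin_numE ?renewal_ge0//; exact: renewal_fin.
Qed.

Variables m m2 e1 : R.
Hypothesis XE : (\int[mu]_(w in [set w | (0 < X w)%R]) (X w)%:E = m%:E)%E.
Hypothesis X2E : (\int[mu]_(w in [set w | (0 < X w)%R]) (X w ^+ 2)%:E = m2%:E)%E.
Hypothesis YE : (\int[mu]_(w in D) (Y w)%:E = e1%:E)%E.
Hypothesis nonlat : forall a : R, 0 < a ->
  mu [set w | exists n : nat, X w = n%:R * a] <> 1%E.

(** Since [m * renewal t - t] is the excess, [m * delayed_renewal t - t] is the
    mean of the excess at [t - Y] minus the mean of [Y]. *)
Lemma delayed_renewal_excess (t : R) :
  (\int[mu]_(w in D) (excess mu X m (t - Y w))%:E =
   (m * fine (delayed_renewal t) - t + e1)%:E)%E.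
Proof.
have m0 := mean_gt0 mX muX XE.
have mg := measurable_excess mX muX m.
have g0 := excess_ge0 mX muX XE.
have uE s : (fine (renewal mu X s))%:E = renewal mu X s.
  by rewrite fineK// renewal_fin.
have u0 s : 0 <= fine (renewal mu X s) by rewrite fine_ge0// renewal_ge0.
have mu_ : measurable_fun [set: R] (fun s => fine (renewal mu X s)).
  by apply: measurableT_comp => //; exact: measurable_renewal.
(* [t] is split into its positive and negative parts, so that every integrand
   is nonnegative *)
pose tp := Num.max t 0; pose tn := Num.max (- t) 0.
have tE : t = tp - tn.
  by rewrite /tp /tn; case: (leP t 0) => t0; [rewrite max_l|rewrite max_r]; lra.
have tp0 : 0 <= tp by rewrite le_max lexx orbT.
have tn0 : 0 <= tn by rewrite le_max lexx orbT.
have e : (\int[mu]_(w in D) (excess mu X m (t - Y w) + tp)%:E =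
   \int[mu]_(w in D) (m * fine (renewal mu X (t - Y w)) + (Y w + tn))%:E)%E.
  by apply: eq_integral => w _; congr EFin; rewrite /excess {2}tE; ring.
have mgY : measurable_fun D (fun w => excess mu X m (t - Y w)) by exact: comp_refl.
have := @ge0_realintD _ _ _ mu D mD (fun w => excess mu X m (t - Y w)) (cst tp)
  mgY (@measurable_cst _ _ _ _ _ _) (fun w _ => g0 _) (fun w _ => tp0).
rewrite e ge0_realintD//; last 4 first.
- by apply: measurable_funM => //; exact: (comp_refl t mu_).
- exact: measurable_funD.
- by move=> w _; rewrite mulr_ge0// ltW.
- by move=> w /= /ltW w0; rewrite addr_ge0.
rewrite ge0_realintZ ?(ltW m0)//; last exact: (comp_refl t mu_).
rewrite ge0_realintD//; last by move=> w /= /ltW.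
under eq_integral do rewrite uE.
rewrite -/(delayed_renewal t) !realint_cst//= muY !mule1 YE.
rewrite -[X in (_ * X)%E](fineK (delayed_renewal_fin t)) -EFinM -!EFinD => /esym h.
have : (\int[mu]_(w in D) (excess mu X m (t - Y w))%:E)%E \is a fin_num.
  by move: h; case: (\int[mu]_(w in D) _)%E.
move=> /fineK; move: h => /[swap] <-; rewrite -EFinD => -[h].
by congr EFin; lra.
Qed.

(** The excess at [t - Y] is close to its limit unless [Y] is of the order of
    [t]; in that case it is at most [C] or, if [Y > t], at most [Y]. *)
Theorem delayed_renewal_cvg (e : R) : 0 < e ->
  exists2 s : R, 0 <= s & forall t : R, s <= t ->
    `|fine (delayed_renewal t) - t / m - m^-1 * (m2 / (2 * m) - e1)| <= e.
Proof.
move=> e0.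
have m0 := mean_gt0 mX muX XE.
have mg := measurable_excess mX muX m.
have g0 := excess_ge0 mX muX XE.
have gm := excess_mono mX muX XE.
have gc (t : R) : 0 <= t -> (\int[mu]_(w in [set w | (0 < X w)%R])
    \int[lebesgue_measure]_(y in `[0%R, X w])
    (excess mu X m (t - y))%:E = (m2 / (2 * m) * m)%:E)%E.
  move=> t0; rewrite (excess_conservation mX muX XE X2E t0); congr EFin.
  by field; rewrite gt_eqF.
have [C C0 gC] := g_bounded mX muX mg g0 gm gc.
have [h h0 hE] : exists2 h : R, 0 < h & h * 2 = m * e.
  by exists (m * e / 2); [rewrite divr_gt0// mulr_gt0|field].
have [s s0 hs] := excess_cvg mX muX XE X2E nonlat h0.
set c := m2 / (2 * m) in hs *.
have c0 : 0 <= `|c| := normr_ge0 c; have cle := ler_norm c.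
have mf : measurable_fun D (fun w => C + `|c| + Y w) by exact: measurable_funD.
have f0 w : D w -> 0 <= C + `|c| + Y w by move=> /= /ltW w0; lra.
have fi : (\int[mu]_(w in D) (C + `|c| + Y w)%:E < +oo)%E.
  rewrite ge0_realintD//.
  - by rewrite YE realint_cst//= muY mule1 -EFinD ltry.
  - by move=> w _; lra.
  - by move=> w /= /ltW.
have [V V0 hV] := realint_tail mD mYD mf f0 fi h0.
exists (s + V) => [|t st]; first lra.
pose tail w := if V < Y w then C + `|c| + Y w else 0.
have mtail : measurable_fun D tail.
  apply: measurable_fun_if => //; first exact: measurable_fun_ltr.
  by apply: measurable_funS mf => // w [].
have tail0 w : D w -> 0 <= tail w.
  by move=> Dw; rewrite /tail; case: ifP => // _; exact: f0.
have mgY : measurable_fun D (fun w => excess mu X m (t - Y w)) by exact: comp_refl.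
have close w : V < Y w = false -> `|excess mu X m (t - Y w) - c| <= h.
  by move=> /negbT; rewrite -leNgt => YV; apply: hs; lra.
have up : (\int[mu]_(w in D) (excess mu X m (t - Y w))%:E <=
           \int[mu]_(w in D) (`|c + h| + tail w)%:E)%E.
  apply: ge0_le_realint => //; first exact: measurable_funD.
  move=> w Dw; rewrite /tail; case: ifPn => [VY|/negbTE/close].
    have := normr_ge0 (c + h); have t0 : 0 <= t by lra.
    have [tY|tY] := ltP (t - Y w) 0; last by have := gC _ tY; lra.
    by rewrite excess_lt0//; lra.
  by rewrite ler_norml => /andP[_ ?]; have := ler_norm (c + h); lra.
have lo : (\int[mu]_(w in D) `|c|%:E <=
           \int[mu]_(w in D) (excess mu X m (t - Y w) + (h + `|c| - c + tail w))%:E)%E.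
  apply: ge0_le_realint => //.
  - apply: measurable_funD => //; exact: measurable_funD.
  - move=> w Dw; rewrite /tail; case: ifPn => [VY|/negbTE/close].
      by have := g0 (t - Y w); have := f0 w Dw; lra.
    by rewrite ler_norml => /andP[? _]; lra.
have ge0c : 0 <= c.
  have : (0 <= (c * m)%:E)%E.
    by rewrite -(gc 0)//; apply: integral_ge0 => w _; apply: integral_ge0 => y _; rewrite lee_fin.
  by rewrite lee_fin pmulr_lge0.
move: up; rewrite (@ge0_realintD _ _ _ mu D mD (cst `|c + h|) tail)//.
rewrite realint_cst//= muY mule1 delayed_renewal_excess => up.
have := le_trans up (leeD (lexx _) hV); rewrite -EFinD lee_fin => {up} up.
have k0 : 0 <= h + `|c| - c by lra.
move: lo; rewrite (@ge0_realintD _ _ _ mu D mD (fun w => excess mu X m (t - Y w))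
  (fun w => h + `|c| - c + tail w))//; last 2 first.
- exact: measurable_funD.
- by move=> w Dw; rewrite addr_ge0 ?tail0.
rewrite (@ge0_realintD _ _ _ mu D mD (cst (h + `|c| - c)) tail)//.
rewrite !realint_cst//= muY !mule1 delayed_renewal_excess => lo.
have := le_trans lo (leeD (lexx _) (leeD (lexx _) hV)); rewrite -!EFinD lee_fin => {lo} lo.
rewrite ger0_norm in up; last lra.
rewrite ger0_norm// in lo.
have -> : fine (delayed_renewal t) - t / m - m^-1 * (c - e1) =
  m^-1 * (m * fine (delayed_renewal t) - t - c + e1).
  by field; rewrite gt_eqF.
rewrite normrM gtr0_norm ?invr_gt0// ler_pdivrMl//.
by rewrite ler_norml; apply/andP; split; lra.
Qed.

End delayed.
(** * Sums of independent variables *)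

Section independent_sums.
Context d (Om : measurableType d) (R : realType) (P : probability Om R).
Local Open Scope ereal_scope.

Lemma measurable_preim (U : Om -> R) (A : set R) :
  measurable_fun [set: Om] U -> measurable A -> measurable (U @^-1` A).
Proof. by move=> mU mA; rewrite -[X in measurable X]setTI; exact: mU. Qed.

(** Two finite measures that agree on rectangles are equal.  The event [F]
    accommodates the coordinates other than [U] and [V]. *)
Lemma joint_law_rectangles (U V : {RV P >-> R}) (F : set Om) : measurable F ->
  (forall A B : set R, measurable A -> measurable B ->
    P (U @^-1` A `&` V @^-1` B `&` F) = P (U @^-1` A) * P (V @^-1` B) * P F) ->
  forall K : set (R * R), measurable K ->
  P ([set w | K (U w, V w)] `&` F) =
  (distribution P U \x distribution P V) K * P F.
Proof.
move=> mF indep K mK.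
have mUV : measurable_fun [set: Om] (fun w => (U w, V w)).
  by apply/measurable_fun_pair.
pose UV : {mfun Om >-> (R * R)%type} :=
  HB.pack (fun w => (U w, V w)) (isMeasurableFun.Build _ _ _ _ _ mUV).
pose k : {nonneg R} := NngNum (fine_ge0 (measure_ge0 P F)).
pose m1 := pushforward (mrestr P mF) UV.
pose m2 := mscale k (distribution P U \x distribution P V).
have PF : (fine (P F))%:E = P F by rewrite fineK// fin_num_measure.
have E : m1 K = m2 K.
  pose G : set (set (R * R)) :=
    [set C | exists A, measurable A /\ exists B, measurable B /\ C = A `*` B].
  apply: (measure_unique G (fun=> setT)) => //.
  - rewrite measurable_prod_measurableType; congr (<<s _ >>).
    apply/seteqP; split => [C [A mA [B mB <-]]|C [A [mA [B [mB ->]]]]].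
      by exists A; split => //; exists B.
    by exists A => //; exists B.
  - move=> _ _ [A [mA [B [mB ->]]]] [A' [mA' [B' [mB' ->]]]].
    rewrite -setXI; exists (A `&` A'); split; first exact: measurableI.
    by exists (B `&` B'); split => //; exact: measurableI.
  - by move=> _; exists setT; split => //; exists setT; split => //; rewrite setXTT.
  - by apply/seteqP; split => // z _; exists 0%N.
  - move=> _ [A [mA [B [mB ->]]]].
    transitivity (P (U @^-1` A `&` V @^-1` B `&` F)); first by [].
    transitivity ((fine (P F))%:E *
      (distribution P U \x distribution P V) (A `*` B)); last by [].
    by rewrite product_measure1E// PF muleC indep.
  - move=> _; change (P (setT `&` F) < +oo).
    by rewrite setTI -ge0_fin_numE// fin_num_measure.
transitivity (m1 K); first by [].
by rewrite E /m2 /mscale/= PF muleC.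
Qed.

Definition RV_of (U : Om -> R) (mU : measurable_fun [set: Om] U) : {RV P >-> R} :=
  HB.pack_for {mfun Om >-> R} U (isMeasurableFun.Build _ _ _ _ _ mU).

Lemma convolution (U V : Om -> R) :
  measurable_fun [set: Om] U -> measurable_fun [set: Om] V ->
  (forall A B : set R, measurable A -> measurable B ->
    P (U @^-1` A `&` V @^-1` B) = P (U @^-1` A) * P (V @^-1` B)) ->
  forall t : R, P [set w | (U w + V w <= t)%R] =
    \int[P]_w P [set v | (V v <= t - U w)%R].
Proof.
move=> mU mV indep t.
pose U' := RV_of mU; pose V' := RV_of mV.
pose K : set (R * R) := [set z | (z.1 + z.2 <= t)%R].
have mK : measurable K.
  have ms : measurable_fun [set: R * R] (fun z : R * R => (z.1 + z.2)%R).
    exact: measurable_funD.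
  rewrite (_ : K = (fun z : R * R => (z.1 + z.2)%R) @^-1` `]-oo, t]).
    by rewrite -[X in measurable X]setTI; exact: ms.
  by apply/seteqP; split => z /=; rewrite in_itv.
have := @joint_law_rectangles U' V' setT measurableT _ K mK.
rewrite setIT probability_setT mule1 => -> /=; last first.
  by move=> A B mA mB; rewrite setIT mule1; exact: indep.
rewrite /product_measure1.
rewrite (@ge0_integral_distribution _ _ _ _ _ P U')//; last first.
  exact: measurable_fun_xsection.
apply: eq_integral => w _ /=; congr (P _).
apply/seteqP; split => v /=.
  by rewrite /xsection/= inE/= lerBrDl.
by rewrite /xsection/= inE/= lerBrDl.
Qed.

Context (I : eqType) (Z : I -> Om -> R).
Hypothesis mZ : forall i, measurable_fun [set: Om] (Z i).
Hypothesis indepZ : mutually_independent P Z.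

Let S (s : seq I) (w : Om) : R := (\sum_(i <- s) Z i w)%R.

Lemma measurable_sum_seq s : measurable_fun [set: Om] (S s).
Proof. exact: measurable_sum. Qed.

Let cyl (J : seq I) (B : I -> set R) := \bigcap_(i in [set` J]) (Z i @^-1` B i).

Let cyl_cons i J B : cyl (i :: J) B = Z i @^-1` B i `&` cyl J B.
Proof.
apply/seteqP; split => w.
  move=> h; split; first by apply: h; rewrite /= mem_head.
  by move=> j /= jJ; apply: h; rewrite /= inE jJ orbT.
by move=> [hi hJ] j /=; rewrite inE => /predU1P[->//|]; exact: hJ.
Qed.

Let cyl_nil B : cyl [::] B = setT.
Proof. by apply/seteqP; split => // w _ j. Qed.

Let mcyl (J : seq I) B : (forall i, i \in J -> measurable (B i)) ->
  measurable (cyl J B).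
Proof.
elim: J => [|i J ih] mB; first by rewrite cyl_nil.
rewrite cyl_cons; apply: measurableI.
  by apply: measurable_preim => //; apply: mB; rewrite mem_head.
by apply: ih => j jJ; apply: mB; rewrite inE jJ orbT.
Qed.

(** Induction on [s].  The cylinder over [J] is carried along, because the step
    needs the induction hypothesis for the cylinder enlarged by the first
    summand [i]: this gives the joint law of [Z i], the rest of the sum and the
    cylinder, hence that of the sum and the cylinder. *)
Lemma independent_sum (s J : seq I) (B : I -> set R) (C : set R) :
  uniq (s ++ J) -> (forall i, i \in J -> measurable (B i)) -> measurable C ->
  P (S s @^-1` C `&` cyl J B) = P (S s @^-1` C) * P (cyl J B).
Proof.
elim: s J B C => [|i s ih] J B C.
  move=> _ mB mC.
  have -> : S [::] = cst 0%R by apply/funext => w; rewrite /S big_nil.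
  rewrite preimage_cst; case: ifPn => _; first by rewrite setTI probability_setT mul1e.
  by rewrite set0I measure0 mul0e.
rewrite /= => /andP[iN us] mB mC.
have iJ : i \notin J by move: iN; rewrite mem_cat negb_or => /andP[].
have iu : uniq (s ++ i :: J).
  by rewrite -cat_rcons cat_uniq -[rcons s i]cats1 -cat_uniq -catA /=
    -(perm_uniq (permEl (perm_catCA [:: i] s J)))/= iN us.
pose U' := RV_of (mZ i); pose V' := RV_of (measurable_sum_seq s).
pose K : set (R * R) := [set z | C (z.1 + z.2)%R].
have mK : measurable K.
  have ms : measurable_fun [set: R * R] (fun z : R * R => (z.1 + z.2)%R).
    exact: measurable_funD.
  by rewrite -[X in measurable X]setTI; exact: ms.
have key J' B' : uniq (s ++ i :: J') -> (forall i, i \in J' -> measurable (B' i)) ->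
  P (S (i :: s) @^-1` C `&` cyl J' B') =
    (distribution P U' \x distribution P V') K * P (cyl J' B').
  move=> uJ mB'.
  rewrite -(@joint_law_rectangles U' V')//; last 2 first.
  - exact: mcyl.
  - move=> A D mA mD.
    have iJ' : i \notin J'.
      by move: uJ; rewrite cat_uniq => /and3P[_ _ /=/andP[]].
    (* [i] is not in [J'], so the constraint [A] on [Z i] can be added to [B'] *)
    pose B2 j := if j == i then A else B' j.
    have e : cyl J' B' = cyl J' B2.
      apply/seteqP; split => w h j /= jJ; have := h j jJ; rewrite /B2;
      by case: eqP => // ji; rewrite -ji jJ in iJ'.
    have mB2 j : j \in i :: J' -> measurable (B2 j).
      by rewrite inE /B2; case: eqP => //= _; exact: mB'.
    have e2 : Z i @^-1` A `&` cyl J' B2 = cyl (i :: J') B2.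
      by rewrite cyl_cons /B2 eqxx.
    rewrite /= e [X in X `&` _]setIC -setIA e2 ih//.
    have -> : P (cyl (i :: J') B2) = P (Z i @^-1` A) * P (cyl J' B2).
      have u1 : uniq (i :: J') by move: uJ; rewrite cat_uniq => /and3P[].
      rewrite /cyl indepZ// indepZ//; last 2 first.
      - by move: u1 => /= /andP[].
      - by move=> j jJ; apply: mB2; rewrite inE jJ orbT.
      by rewrite big_cons /B2 eqxx.
    by rewrite muleA [X in X * _]muleC.
  congr (P (_ `&` _)).
  by apply/seteqP; split => w /=; rewrite /S big_cons.
rewrite key//; congr (_ * _).
have := key [::] B; rewrite cats1 rcons_uniq.
rewrite cyl_nil setIT probability_setT mule1 => ->//.
by move: iN us; rewrite mem_cat negb_or cat_uniq => /andP[-> _] /andP[].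
Qed.

Lemma independent_sum_last (s : seq I) (i : I) (A B : set R) :
  uniq (rcons s i) -> measurable A -> measurable B ->
  P (S s @^-1` A `&` Z i @^-1` B) = P (S s @^-1` A) * P (Z i @^-1` B).
Proof.
rewrite -cats1 => us mA mB.
have := @independent_sum s [:: i] (fun=> B) A us _ mA.
have -> : cyl [:: i] (fun=> B) = Z i @^-1` B.
  by apply/seteqP; split => w; [apply; rewrite /= mem_head|move=> h j /=; rewrite inE => /eqP ->].
by apply.
Qed.

End independent_sums.
(** * Sums over countable index sets *)

Section countable_sums.
Local Open Scope ereal_scope.

Lemma counting_esum (R : realType) (U : choiceType) (A : set U) :
  counting A = \esum_(u in A) (1 : \bar R).
Proof.
rewrite /counting; case: asboolP => [finA|infA].
  rewrite esum_fset// fsbig_finite//= big_const_seq count_predT.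
  by elim: (size _) => //= n <-; rewrite -EFinD -natr1 addrC.
apply/esym/eqyP => r r0.
have [B BA Bn] := infinite_set_fset (Num.truncn r).+1 infA.
pose s := finmap.enum_fset B.
apply: esum_ge; exists [set` s]; first by split; [exact: finite_seq|exact: BA].
rewrite -(fsbig_seq _ _ (finmap.fset_uniq B)).
have -> : \sum_(i <- s) (1 : \bar R) = (size s)%:R%:E.
  rewrite big_const_seq count_predT.
  by elim: (size _) => //= n ->; rewrite -EFinD -natr1 addrC.
rewrite lee_fin (le_trans (ltW (truncnS_gt r)))// ler_nat.
exact: leq_trans Bn.
Qed.

(** An enumeration reduces sums over a countable index set to series, hence their
    integration to monotone convergence. *)
Lemma esum_countable (R : realType) (U : countType) (A : set U) (f : U -> \bar R) :
  (forall u, A u -> 0 <= f u) ->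
  \esum_(u in A) f u = \sum_(n <oo)
    (if @pickle_inv U n is Some u then if u \in A then f u else 0 else 0).
Proof.
move=> f0; pose a (n : nat) := if @pickle_inv U n is Some u then if u \in A then f u else 0 else 0.
have a0 n : 0 <= a n.
  by rewrite /a; case: pickle_inv => // u; case: ifPn => // /set_mem /f0.
rewrite (nneseries_esumT a0).
transitivity (esum A (fun u : U => a (choice.pickle u))).
  by apply: eq_esum => u Au; rewrite /a pickleK_inv mem_set.
rewrite -(@esum_image _ _ _ A (@choice.pickle U) a); last first.
  by move=> u v _ _; exact: (pcan_inj choice.pickleK).
rewrite esum_mkcond; apply: eq_esum => n _.
case: ifPn => // nA; rewrite /a; case E : (@pickle_inv U n) => [u|//].
case: ifPn => // uA; exfalso; move/negP: nA; apply; apply: mem_set.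
exists u; first exact: set_mem uA.
by have := @pickle_invK U n; rewrite E.
Qed.

Lemma integral_esum d (T : measurableType d) (R : realType)
    (mu : {measure set T -> \bar R}) (D : set T) (U : countType) (A : set U)
    (f : U -> T -> \bar R) :
  measurable D -> (forall u, A u -> measurable_fun D (f u)) ->
  (forall u x, A u -> 0 <= f u x) ->
  \int[mu]_(x in D) (\esum_(u in A) f u x) = \esum_(u in A) \int[mu]_(x in D) f u x.
Proof.
move=> mD mf f0.
rewrite esum_countable; last by move=> u Au; apply: integral_ge0 => x _; exact: f0.
transitivity (\int[mu]_(x in D) \sum_(n <oo)
    (if @pickle_inv U n is Some u then if u \in A then f u x else 0 else 0)).
  by apply: eq_integral => x _; rewrite esum_countable// => u; exact: f0.
rewrite integral_nneseries//.
- apply: eq_eseriesr => n _; case: pickle_inv => [u|]; last by rewrite integral0.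
  by case: ifP => // _; rewrite integral0.
- move=> n; case: pickle_inv => [u|]; last exact: measurable_cst.
  case: (boolP (u \in A)) => [uA|_]; last exact: measurable_cst.
  by apply: mf; exact: set_mem uA.
- move=> n x _; case: pickle_inv => [u|]//.
  by case: ifPn => // uA; apply: f0; exact: set_mem uA.
Qed.

Lemma esumZl (R : realType) (U : countType) (A : set U) (f : U -> \bar R) (k : R) :
  (0 <= k)%R -> (forall u, A u -> 0 <= f u) ->
  \esum_(u in A) (k%:E * f u) = k%:E * \esum_(u in A) f u.
Proof.
move=> k0 f0; rewrite !esum_countable//; last first.
  by move=> u Au; rewrite mule_ge0// ?lee_fin ?f0.
rewrite -nneseriesZl//.
  apply: eq_eseriesr => n _; case: pickle_inv => [u|]; last by rewrite mule0.
  by case: ifP => //; rewrite mule0.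
by move=> n _; case: pickle_inv => [u|]//; case: ifPn => // uA; apply: f0; exact: set_mem uA.
Qed.

End countable_sums.
(** * Means of sums over a random point configuration *)

Section campbell.
Context d (Om : measurableType d) (R : realType) (P : probability Om R).
Variables (U : countType) (W : set U) (B : U -> Om -> R).
Hypothesis mB : forall u, measurable_fun setT (B u).
Local Open Scope ereal_scope.

(** The mean of the sum of [F] over the nonnegative points [B u], as a functional
    of [F] (Campbell's formula); it is linear and monotone on nonnegative
    functions. *)
Definition campbell (F : R -> \bar R) : \bar R :=
  \esum_(u in W) \int[P]_(w in [set w | (0 <= B u w)%R]) F (B u w).

Definition campbell_count (t : R) : \bar R :=
  campbell (fun x => (x <= t)%R%:R%:E).

Let mD u : measurable [set w | (0 <= B u w)%R].
Proof. exact: (measurable_ge_level (mB u)). Qed.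

Let mFB (F : R -> \bar R) u : measurable_fun setT F ->
  measurable_fun [set w | (0 <= B u w)%R] (fun w => F (B u w)).
Proof.
by move=> mF; apply: (@measurable_funS _ _ _ _ setT) => //; exact: (measurableT_comp mF (mB u)).
Qed.

Lemma campbell_ge0 (F : R -> \bar R) : (forall x : R, 0 <= F x) -> 0 <= campbell F.
Proof.
move=> F0; apply: esum_ge0 => u _; apply: integral_ge0 => w _; exact: F0.
Qed.

Lemma le_campbell (F G : R -> \bar R) : measurable_fun setT F -> measurable_fun setT G ->
  (forall x : R, (0 <= x)%R -> 0 <= F x) -> (forall x : R, (0 <= x)%R -> F x <= G x) ->
  campbell F <= campbell G.
Proof.
move=> mF mG F0 FG; apply: le_esum => u _; apply: ge0_le_integral => //.
- by move=> w /=; exact: F0.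
- exact: mFB.
- exact: mFB.
- by move=> w /=; exact: FG.
Qed.

Lemma campbellD (F G : R -> \bar R) : measurable_fun setT F -> measurable_fun setT G ->
  (forall x : R, 0 <= F x) -> (forall x : R, 0 <= G x) ->
  campbell (fun x => F x + G x) = campbell F + campbell G.
Proof.
move=> mF mG F0 G0; rewrite /campbell -esumD; last 2 first.
- by move=> u _; apply: integral_ge0.
- by move=> u _; apply: integral_ge0.
by apply: eq_esum => u _; rewrite ge0_integralD//; exact: mFB.
Qed.

Lemma campbellZ (F : R -> \bar R) (k : R) : (0 <= k)%R -> measurable_fun setT F ->
  (forall x : R, 0 <= F x) -> campbell (fun x => k%:E * F x) = k%:E * campbell F.
Proof.
move=> k0 mF F0; rewrite /campbell -esumZl//; last first.
  by move=> u _; apply: integral_ge0.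
by apply: eq_esum => u _; rewrite ge0_integralZl_EFin//; exact: mFB.
Qed.

Lemma measurable_le_ind (t : R) :
  measurable_fun setT (fun x : R => (x <= t)%R%:R%:E : \bar R).
Proof.
rewrite (_ : (fun _ => _) = EFin \o (\1_(`]-oo, t]%classic) : R -> R))//.
  by apply/measurable_EFinP; exact: measurable_indic.
apply/funext => x /=; rewrite indicE; congr (_%:R%:E).
by rewrite mem_setE in_itv.
Qed.

Lemma measurable_pos_part (t : R) :
  measurable_fun setT (fun x : R => (Num.max 0 (t - x))%R%:E : \bar R).
Proof.
apply/measurable_EFinP; apply: measurable_maxr; first exact: measurable_cst.
by apply: measurable_funB; [exact: measurable_cst|exact: measurable_id].
Qed.

Lemma campbell_count_ge0 t : 0 <= campbell_count t.
Proof. by apply: campbell_ge0 => x; rewrite lee_fin. Qed.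

Lemma campbell_count_mono : {homo campbell_count : s t / (s <= t)%R >-> s <= t}.
Proof.
move=> s t st; apply: le_campbell; try exact: measurable_le_ind.
  by move=> x _; rewrite lee_fin.
move=> x _; rewrite lee_fin ler_nat; case: (leP x s) => //= xs.
by rewrite (le_trans xs st).
Qed.

(** The layer-cake identity: for [x >= 0] the positive part of [t - x] is the
    length of the set of [y] in [0, t] with [x <= y]. *)
Lemma campbell_pos_part t : (0 <= t)%R ->
  campbell (fun x => (Num.max 0 (t - x))%R%:E) =
  \int[lebesgue_measure]_(y in `[0%R, t]) campbell_count y.
Proof.
move=> t0; rewrite /campbell_count /campbell.
have mjoint u : measurable_fun setT
    (fun p : Om * R => (B u p.1 <= p.2)%R%:R%:E : \bar R).
  rewrite (_ : (fun _ => _) = (fun x : R => (x <= 0)%R%:R%:E) \o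
      (fun p : Om * R => (B u p.1 - p.2)%R)); last first.
    by apply/funext => p /=; rewrite subr_le0.
  apply: measurableT_comp; first exact: measurable_le_ind.
  by apply: measurable_funB; [exact: measurableT_comp|exact: measurable_snd].
rewrite integral_esum//.
- apply: eq_esum => u _.
  rewrite -(@fubini_tonelli_dom _ _ _ _ _ P (@lebesgue_measure R) _ `[0%R, t]
    (fun w y => (B u w <= y)%R%:R%:E))//.
  + apply: eq_integral => w /set_mem/= w0.
    case: (leP (B u w) t) => wt.
      rewrite max_r ?subr_ge0//.
      rewrite (@eq_integral _ _ _ lebesgue_measure `[0%R, t]
         (fun y => (\1_(`[B u w, t]%classic) y)%:E)); last first.
        by move=> y /set_mem/=; rewrite in_itv/= => /andP[y0 yt]; rewrite indicE mem_setE in_itv/= yt andbT.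
      rewrite integral_indic//= setIidl.
        by rewrite lebesgue_measure_itv/= lte_fin; case: ltgtP wt => // -> _; rewrite subrr.
      by move=> y /=; rewrite !in_itv/= => /andP[wy ->]; rewrite (le_trans w0 wy).
    rewrite max_l ?subr_le0 1?ltW// integral0_eq// => y /=; rewrite in_itv/= => /andP[y0 yt].
    by rewrite leNgt (le_lt_trans yt wt).
  + exact: mjoint.
- move=> u _.
  apply: (@measurable_funS _ _ _ _ setT) => //.
  apply: nondecreasing_emeasurable => s s' ss'.
  apply: ge0_le_integral => //.
  + exact: (@mFB _ u (measurable_le_ind s)).
  + exact: (@mFB _ u (measurable_le_ind s')).
  + move=> w _; rewrite lee_fin ler_nat; case: (leP (B u w) s) => //= xs.
    by rewrite (le_trans xs ss').
- by move=> u y _; apply: integral_ge0 => w _; rewrite lee_fin.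
Qed.


Lemma campbell_pos_part_fin t : (0 <= t)%R -> campbell_count t < +oo ->
  \int[lebesgue_measure]_(y in `[0%R, t]) campbell_count y < +oo.
Proof.
move=> t0 vt; rewrite -campbell_pos_part//.
apply: (@le_lt_trans _ _ (t%:E * campbell_count t)); last first.
  by rewrite lte_mul_pinfty// lee_fin.
rewrite /campbell_count -campbellZ//; last exact: measurable_le_ind.
apply: le_campbell; first exact: measurable_pos_part.
- apply: measurable_funeM; exact: measurable_le_ind.
- by move=> x _; rewrite lee_fin le_max lexx.
move=> x x0; rewrite -EFinM lee_fin; case: (leP x t) => xt /=.
  by rewrite mulr1 ge_max t0/= gerBl.
by rewrite mulr0 ge_max lexx/= subr_le0 ltW.
Qed.

Section renewal_type_kernel.
Variables (G : R -> \bar R) (m b : R).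
Hypothesis m0 : (0 < m)%R.
Hypothesis G0 : forall x, 0 <= G x.
Hypothesis Gmono : {homo G : s t / (s <= t)%R >-> s <= t}.
Hypothesis Glt0 : forall x, (x < 0)%R -> G x = 0.
Hypothesis Gfin : forall x, G x < +oo.
Hypothesis Gcvg : forall e : R, (0 < e)%R -> exists2 s : R, (0 <= s)%R &
  forall t : R, (s <= t)%R -> (`|fine (G t) - t / m - b| <= e)%R.
Hypothesis count_fin : forall t, campbell_count t < +oo.

(** Away from the end point [t] the kernel is within [e] of its asymptote, and
    on the last [s] units of time it is merely bounded; the points that fall
    there are counted by an increment of the counting function. *)
Lemma campbell_kernel (e : R) : (0 < e)%R -> exists s C : R,
  [/\ (0 <= s)%R, (0 <= C)%R & forall t : R, (0 <= t)%R ->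
  campbell (fun x => G (t - x)%R) \is a fin_num /\
  (`|fine (campbell (fun x => G (t - x)%R))
   - m^-1 * fine (\int[lebesgue_measure]_(y in `[0%R, t]) campbell_count y)
   - b * fine (campbell_count t)| <=
  e * fine (campbell_count t) +
  C * (fine (campbell_count t) - fine (campbell_count (t - s))))%R].
Proof.
move=> e0; have [s s0 sP] := Gcvg e0.
have Gs := Gfin s.
(* [C] dominates both the kernel and its asymptote on [0, s] *)
have [C [CG Cs Cb]] : exists C : R, [/\ (fine (G s) + `|b| <= C)%R,
    (s / m + `|b| <= C)%R & (`|b| <= C)%R].
  exists (fine (G s) + s / m + `|b|)%R.
  have h1 : (0 <= fine (G s))%R by exact: fine_ge0.
  have h2 : (0 <= s / m)%R by rewrite divr_ge0// ltW.
  by split; lra.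
have C0 : (0 <= C)%R by apply: le_trans Cb.
exists s, C; split=> // t t0.
have mG : measurable_fun setT (fun x : R => G (t - x)%R).
  apply: (measurableT_comp (nondecreasing_emeasurable Gmono)).
  by apply: measurable_funB; [exact: measurable_cst|exact: measurable_id].
have GE x : G x = (fine (G x))%:E by rewrite fineK// ge0_fin_numE.
(* Both inequalities are arranged to have nonnegative terms only. *)
have key x (y := (t - x)%R) : 
    (fine (G y) + C * (x <= t - s)%R%:R <=
       m^-1 * Num.max 0 y + (b + e + C) * (x <= t)%R%:R)%R /\
    (m^-1 * Num.max 0 y + ((b + C) * (x <= t)%R%:R + C * (x <= t - s)%R%:R) <=
       fine (G y) + (e + 2 * C) * (x <= t)%R%:R)%R.
  have b1 := ler_norm b; have b2 : (- b <= `|b|)%R by rewrite -normrN ler_norm.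
  have -> : (x <= t)%R = (0 <= y)%R by rewrite subr_ge0.
  have -> : (x <= t - s)%R = (s <= y)%R by rewrite /y lerBrDr lerBrDl addrC.
  have [sy|ys] := leP s y.
    have y0 := le_trans s0 sy; rewrite y0 max_r//=.
    have := sP _ sy; rewrite ler_norml (mulrC y) => /andP[]; lra.
  have [y0|y0] := leP 0%R y; last first.
    by rewrite Glt0//=; lra.
  rewrite /=.
  have h1 : (fine (G y) <= fine (G s))%R.
    by apply: fine_le; rewrite ?ge0_fin_numE//; apply: Gmono; exact: ltW.
  have h2 : (0 <= fine (G y))%R by exact: fine_ge0.
  have h3 : (m^-1 * y <= s / m)%R.
    by rewrite mulrC ler_pM2r ?invr_gt0// ltW.
  have h4 : (0 <= m^-1 * y)%R by rewrite mulr_ge0// invr_ge0 ltW.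
  split; lra.
pose i r := fun x : R => (x <= r)%R%:R%:E : \bar R.
pose p := fun x : R => (Num.max 0 (t - x))%R%:E : \bar R.
have mi r : measurable_fun setT (i r) by exact: measurable_le_ind.
have mp : measurable_fun setT p by exact: measurable_pos_part.
have i0 r (x : R) : 0 <= i r x by rewrite lee_fin.
have p0 (x : R) : 0 <= p x by rewrite lee_fin le_max lexx.
have ki0 (k : R) r (x : R) : (0 <= k)%R -> 0 <= k%:E * i r x.
  by move=> k0; rewrite mule_ge0// lee_fin.
have mki (k : R) r : measurable_fun setT (fun x => k%:E * i r x).
  exact: measurable_funeM.
have mV0 : (0 <= m^-1)%R by rewrite invr_ge0 ltW.
have bC0 : (0 <= b + C)%R by have : (- b <= `|b|)%R; [rewrite -normrN ler_norm|lra].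
have bCe0 : (0 <= b + e + C)%R by lra.
have eC0 : (0 <= e + 2 * C)%R by lra.
have cZ (k r : R) : (0 <= k)%R ->
    k%:E * campbell_count r = campbell (fun x => k%:E * i r x).
  by move=> k0; rewrite campbellZ.
have cp : (m^-1)%:E * campbell p = campbell (fun x => (m^-1)%:E * p x).
  by rewrite campbellZ.
have mmp : measurable_fun setT (fun x => (m^-1)%:E * p x).
  exact: measurable_funeM.
have mp0 (x : R) : 0 <= (m^-1)%:E * p x by rewrite mule_ge0// lee_fin.
have mii : measurable_fun setT
    (fun x => (b + C)%:E * i t x + C%:E * i (t - s)%R x).
  exact: emeasurable_funD.
have ii0 (x : R) : 0 <= (b + C)%:E * i t x + C%:E * i (t - s)%R x.
  by rewrite adde_ge0// ki0.
have UB : campbell (fun x => G (t - x)%R) + C%:E * campbell_count (t - s) <=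
    (m^-1)%:E * campbell p + (b + e + C)%:E * campbell_count t.
  rewrite cp !cZ// -(campbellD mG (mki C (t - s)%R))//; last by move=> x; exact: ki0.
  rewrite -(campbellD mmp (mki (b + e + C)%R t))//; last by move=> x; exact: ki0.
  apply: le_campbell.
  - exact: emeasurable_funD.
  - exact: emeasurable_funD.
  - by move=> x _; rewrite adde_ge0// ki0.
  - by move=> x _; rewrite GE -!EFinM -!EFinD lee_fin; have [] := key x.
have LB : (m^-1)%:E * campbell p + ((b + C)%:E * campbell_count t + C%:E * campbell_count (t - s)) <=
    campbell (fun x => G (t - x)%R) + (e + 2 * C)%:E * campbell_count t.
  rewrite (cZ (b + C)%R)// (cZ C)// (cZ (e + 2 * C)%R)// cp.
  rewrite -(campbellD (mki (b + C)%R t) (mki C (t - s)%R)); last 2 first.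
  - by move=> x; exact: ki0.
  - by move=> x; exact: ki0.
  rewrite -(campbellD mmp mii)//.
  rewrite -(campbellD mG (mki (e + 2 * C)%R t))//; last by move=> x; exact: ki0.
  apply: le_campbell.
  - exact: emeasurable_funD.
  - exact: emeasurable_funD.
  - by move=> x _; rewrite adde_ge0.
  - by move=> x _; rewrite GE -!EFinM -!EFinD lee_fin; have [] := key x.
have cE r : campbell_count r = (fine (campbell_count r))%:E.
  by rewrite fineK// ge0_fin_numE// campbell_count_ge0.
have := campbell_pos_part_fin t0 (count_fin t).
rewrite -campbell_pos_part// -/p => Jfin.
have JE : campbell p = (fine (campbell p))%:E.
  by rewrite fineK// ge0_fin_numE// campbell_ge0.
have Ffin : campbell (fun x => G (t - x)%R) \is a fin_num.
  rewrite ge0_fin_numE ?campbell_ge0//.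
  apply: (@le_lt_trans _ _ ((m^-1)%:E * campbell p + (b + e + C)%:E * campbell_count t)).
    by apply: le_trans UB; rewrite leeDl// mule_ge0// ?lee_fin// campbell_count_ge0.
  by rewrite JE (cE t) -!EFinM -EFinD ltry.
split => //.
move: UB LB; rewrite -(fineK Ffin) JE (cE t) (cE (t - s)%R) -!EFinM -!EFinD !lee_fin.
by rewrite ler_norml; lra.
Qed.

End renewal_type_kernel.
End campbell.
(** * Two-term polynomial expansions *)

Section expansions.
Context (R : realType).

Definition expansion (v : R -> R) (al be : R) (j : nat) : Prop :=
  forall e : R, 0 < e -> exists2 s : R, 0 <= s &
    forall t : R, s <= t -> `|v t - al * t ^+ j.+1 - be * t ^+ j| <= e * t ^+ j.

Lemma integral_pow (l t : R) (i : nat) : 0 <= l -> 0 <= t ->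
  (\int[lebesgue_measure]_(y in `[0%R, t]) (l%:E * (y ^+ i)%:E) =
   (l * (t ^+ i.+1 / i.+1%:R))%:E)%E.
Proof.
move=> l0 t0; rewrite EFinM -integral_itv_pow//.
apply: ge0_integralZl_EFin => //.
  by move=> y /=; rewrite in_itv/= => /andP[y0 _]; rewrite lee_fin exprn_ge0.
by apply/measurable_EFinP; apply: measurable_funX; exact: measurable_id.
Qed.

Lemma integral_pow_ind (a b c s t : R) (n k : nat) :
  0 <= a -> 0 <= b -> 0 <= c -> 0 <= s -> 0 <= t ->
  (\int[lebesgue_measure]_(y in `[0%R, t])
     (a%:E * (y ^+ n)%:E + (b%:E * (y ^+ k)%:E + c%:E * (\1_(`[0%R, s]%classic) y)%:E)) <=
   (a * (t ^+ n.+1 / n.+1%:R) + (b * (t ^+ k.+1 / k.+1%:R) + c * s))%:E)%E.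
Proof.
move=> a0 b0 c0 s0 t0.
have mpow (i : nat) : measurable_fun `[0%R, t] (fun y : R => (y ^+ i)%:E).
  by apply/measurable_EFinP; apply: measurable_funX; exact: measurable_id.
have mind : measurable_fun `[0%R, t] (fun y : R => (\1_(`[0%R, s]%classic) y)%:E : \bar R).
  by apply/measurable_EFinP; apply: measurable_indic.
have pow0 (i : nat) (y : R) : `[0%R, t]%classic y -> (0 <= (y ^+ i)%:E)%E.
  by rewrite /= in_itv/= => /andP[y0 _]; rewrite lee_fin exprn_ge0.
have ind0 (y : R) : (0 <= (\1_(`[0%R, s]%classic) y : R)%:E)%E by rewrite lee_fin.
have mkp (l : R) (i : nat) : measurable_fun `[0%R, t] (fun y : R => l%:E * (y ^+ i)%:E)%E.
  by apply: measurable_funeM; exact: mpow.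
have mki : measurable_fun `[0%R, t] (fun y : R => c%:E * (\1_(`[0%R, s]%classic) y)%:E)%E.
  by apply: measurable_funeM; exact: mind.
have kp0 (l : R) (i : nat) (y : R) : 0 <= l -> `[0%R, t]%classic y -> (0 <= l%:E * (y ^+ i)%:E)%E.
  by move=> l0 yt; apply: mule_ge0; rewrite ?lee_fin//; exact: pow0.
have ki0 (y : R) : (0 <= c%:E * (\1_(`[0%R, s]%classic) y)%:E)%E.
  by apply: mule_ge0; rewrite ?lee_fin.
rewrite ge0_integralD//; last 4 first.
- by move=> y; exact: kp0.
- exact: mkp.
- by move=> y yt; apply: adde_ge0 => //; exact: kp0.
- by apply: emeasurable_funD; [exact: mkp|exact: mki].
rewrite ge0_integralD//; last 2 first.
- by move=> y; exact: kp0.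
- exact: mkp.
have Ii : (\int[lebesgue_measure]_(y in `[0%R, t]) (c%:E * (\1_(`[0%R, s]%classic) y)%:E) =
     c%:E * \int[lebesgue_measure]_(y in `[0%R, t]) (\1_(`[0%R, s]%classic) y)%:E)%E.
  by apply: ge0_integralZl_EFin.
rewrite !integral_pow// Ii !EFinD leeD2l// leeD2l// EFinM.
apply: lee_wpmul2l; rewrite ?lee_fin// integral_indic//=.
apply: (@le_trans _ _ (lebesgue_measure `[0%R, s])).
  apply: le_measure => //; apply: mem_set => //.
  exact: (measurableI _ _ (measurable_itv _) (measurable_itv _)).
by rewrite lebesgue_measure_itv/= lte_fin; case: ifP => _; rewrite ?sube0 lee_fin.
Qed.

Lemma pow_increment (n : nat) (s t : R) : 0 <= s -> s <= t ->
  t ^+ n.+1 - (t - s) ^+ n.+1 <= n.+1%:R * s * t ^+ n.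
Proof.
move=> s0 st; have t0 := le_trans s0 st.
elim: n => [|n IH]; first by rewrite !expr1 expr0; lra.
have h : (t - s) ^+ n.+1 <= t ^+ n.+1 by apply: lerXn2r; rewrite ?nnegrE; lra.
have -> : t ^+ n.+2 - (t - s) ^+ n.+2 =
  t * (t ^+ n.+1 - (t - s) ^+ n.+1) + s * (t - s) ^+ n.+1 by rewrite !(exprS _ n.+1); ring.
have h1 : t * (t ^+ n.+1 - (t - s) ^+ n.+1) <= t * (n.+1%:R * s * t ^+ n).
  exact: ler_wpM2l.
have h2 : s * (t - s) ^+ n.+1 <= s * t ^+ n.+1 by exact: ler_wpM2l.
apply: le_trans (lerD h1 h2) _; rewrite le_eqVlt; apply/orP; left; apply/eqP.
by rewrite -(@natr1 _ n.+1) (exprS t n); ring.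
Qed.

Section integral_expansion.
Variable V : R -> \bar R.
Hypothesis V0 : forall t, (0 <= V t)%E.
Hypothesis Vmono : {homo V : s t / s <= t >-> (s <= t)%E}.
Hypothesis Vfin : forall t, (V t < +oo)%E.

(** The expansion may fail on an initial segment [0, s], which contributes a
    bounded amount [C * s] to the integral, and that is [o(t ^ j.+1)]. *)
Lemma integral_expansion (al be : R) (j : nat) : 0 <= al ->
  expansion (fine \o V) al be j ->
  expansion (fun t => fine (\int[lebesgue_measure]_(y in `[0%R, t]) V y)%E)
    (al / j.+2%:R) (be / j.+1%:R) j.+1.
Proof.
move=> al0 ve e e0.
have e20 : 0 < e / 2 by lra.
have [s s0 sP] := ve _ e20.
have VE y : V y = (fine (V y))%:E by rewrite fineK// ge0_fin_numE.
have v0 y : 0 <= fine (V y) by exact: fine_ge0.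
(* [K * y ^+ j] is added on both sides to make the coefficients nonnegative *)
pose K := `|be|.
have K0 : 0 <= K by exact: normr_ge0.
have b1 : be <= K by exact: ler_norm.
have b2 : - be <= K by rewrite /K -normrN ler_norm.
have [C CE] : exists C : R, C = fine (V s) + al * s ^+ j.+1 + K * s ^+ j by eexists.
have p1 : 0 <= al * s ^+ j.+1 by rewrite mulr_ge0// exprn_ge0.
have p2 : 0 <= K * s ^+ j by rewrite mulr_ge0// exprn_ge0.
have C0 : 0 <= C by rewrite CE; have := v0 s; lra.
have key (y : R) : 0 <= y ->
    fine (V y) + K * y ^+ j <=
      al * y ^+ j.+1 + ((be + K + e / 2) * y ^+ j + C * \1_(`[0, s]%classic) y) /\
    al * y ^+ j.+1 + ((be + K) * y ^+ j + 0 * \1_(`[0, s]%classic) y) <=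
      fine (V y) + ((K + e / 2) * y ^+ j + C * \1_(`[0, s]%classic) y).
  move=> y0; rewrite indicE mem_setE in_itv/= y0/=.
  have q0 : 0 <= y ^+ j by exact: exprn_ge0.
  have q1 : 0 <= al * y ^+ j.+1 by rewrite mulr_ge0// exprn_ge0.
  have q2 : 0 <= (be + K) * y ^+ j by rewrite mulr_ge0//; lra.
  have q3 : 0 <= (e / 2) * y ^+ j by rewrite mulr_ge0//; lra.
  have [ys|ys] := leP y s; last first.
    have := sP _ (ltW ys); rewrite /= ler_norml => /andP[]; lra.
  have r1 : fine (V y) <= fine (V s).
    by apply: fine_le; rewrite ?ge0_fin_numE//; exact: Vmono.
  have r2 : al * y ^+ j.+1 <= al * s ^+ j.+1.
    by apply: ler_wpM2l => //; apply: lerXn2r.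
  have r3 : K * y ^+ j <= K * s ^+ j.
    by apply: ler_wpM2l => //; apply: lerXn2r.
  have r4 : be * y ^+ j <= K * y ^+ j by apply: ler_wpM2r.
  have := v0 y; rewrite /= !mulr1; split; lra.
exists (Num.max 1 (2 * C * s / e)); first by rewrite le_max ler01.
move=> t; rewrite ge_max => /andP[t1 tC].
have t0 : 0 <= t by lra.
have mV (D : set R) : measurable D -> measurable_fun D V.
  by move=> mD; apply: (@measurable_funS _ _ _ _ setT) => //; exact: nondecreasing_emeasurable.
have mI := measurable_itv `[0%R, t].
have mpow (i : nat) : measurable_fun `[0%R, t] (fun y : R => (y ^+ i)%:E).
  by apply/measurable_EFinP; apply: measurable_funX; exact: measurable_id.
have mind : measurable_fun `[0%R, t] (fun y : R => (\1_(`[0%R, s]%classic) y)%:E : \bar R).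
  by apply/measurable_EFinP; apply: measurable_indic.
have [J JE] : exists J : R, (\int[lebesgue_measure]_(y in `[0%R, t]) V y = J%:E)%E.
  exists (fine (\int[lebesgue_measure]_(y in `[0%R, t]) V y)%E).
  rewrite fineK// ge0_fin_numE; last exact: integral_ge0.
  apply: (@le_lt_trans _ _ (\int[lebesgue_measure]_(y in `[0%R, t]) (fine (V t))%:E)%E).
    apply: ge0_le_integral => //; first exact: mV.
    by move=> y /=; rewrite in_itv/= => /andP[_ yt]; rewrite -VE Vmono.
  by rewrite integral_cst//= lebesgue_measure_itv/=; case: ifP => _; rewrite -?EFinM ?mule0 ltry.
have KE (k : R) : 0 <= k -> (\int[lebesgue_measure]_(y in `[0%R, t]) (V y + k%:E * (y ^+ j)%:E) =
   (J + k * (t ^+ j.+1 / j.+1%:R))%:E)%E.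
  move=> k0; rewrite ge0_integralD//; last 3 first.
  - exact: mV.
  - by move=> y /=; rewrite in_itv/= => /andP[y0 _]; rewrite mule_ge0// lee_fin// exprn_ge0.
  - by apply: measurable_funeM; exact: mpow.
  by rewrite integral_pow// JE -EFinD.
have bK0 : 0 <= be + K by lra.
have bKe0 : 0 <= be + K + e / 2 by lra.
have Ke0 : 0 <= K + e / 2 by lra.
have mpk (l : R) (i : nat) : measurable_fun `[0%R, t] (fun y : R => l%:E * (y ^+ i)%:E)%E.
  by apply: measurable_funeM; exact: mpow.
have mki (l : R) : measurable_fun `[0%R, t] (fun y : R => l%:E * (\1_(`[0%R, s]%classic) y)%:E)%E.
  by apply: measurable_funeM; exact: mind.
have kp0 (l : R) (i : nat) (y : R) : 0 <= l -> `[0%R, t]%classic y -> (0 <= l%:E * (y ^+ i)%:E)%E.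
  move=> l0; rewrite /= in_itv/= => /andP[y0 _].
  by apply: mule_ge0; rewrite ?lee_fin// exprn_ge0.
have ki0 (l y : R) : 0 <= l -> (0 <= l%:E * (\1_(`[0%R, s]%classic) y)%:E)%E.
  by move=> l0; apply: mule_ge0; rewrite ?lee_fin.
have upper : J + K * (t ^+ j.+1 / j.+1%:R) <=
    al * (t ^+ j.+2 / j.+2%:R) + ((be + K + e / 2) * (t ^+ j.+1 / j.+1%:R) + C * s).
  rewrite -lee_fin -KE//.
  apply: le_trans (integral_pow_ind j.+1 j al0 bKe0 C0 s0 t0).
  apply: ge0_le_integral => //.
  - by move=> y yt; apply: adde_ge0 => //; exact: kp0.
  - by apply: emeasurable_funD; [exact: mV|exact: mpk].
  - apply: emeasurable_funD; first exact: mpk.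
    by apply: emeasurable_funD; [exact: mpk|exact: mki].
  - move=> y; rewrite /= in_itv/= => /andP[y0 _].
    by rewrite VE -!EFinM -!EFinD lee_fin; have [] := key _ y0.
have lower : al * (t ^+ j.+2 / j.+2%:R) + (be + K) * (t ^+ j.+1 / j.+1%:R) <=
    J + (K + e / 2) * (t ^+ j.+1 / j.+1%:R) + C * s.
  have h : (\int[lebesgue_measure]_(y in `[0%R, t]) (C%:E * (\1_(`[0%R, s]%classic) y)%:E) <=
      (C * s)%:E)%E.
    have := integral_pow_ind 0 0 (lexx 0) (lexx 0) C0 s0 t0.
    rewrite !mul0r !add0r; apply: le_trans; rewrite le_eqVlt; apply/orP; left; apply/eqP.
    by apply: eq_integral => y _; rewrite !mul0e !add0e.
  rewrite -lee_fin EFinD; apply: (@le_trans _ _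
   (\int[lebesgue_measure]_(y in `[0%R, t]) (V y + (K + e / 2)%:E * (y ^+ j)%:E) +
    \int[lebesgue_measure]_(y in `[0%R, t]) (C%:E * (\1_(`[0%R, s]%classic) y)%:E))%E); last first.
    by rewrite KE// [leRHS]EFinD leeD2l.
  rewrite -!integral_pow// -!ge0_integralD//; last 8 first.
  - by move=> y yt; apply: adde_ge0 => //; exact: kp0.
  - by apply: emeasurable_funD; [exact: mV|exact: mpk].
  - by move=> y _; exact: ki0.
  - exact: mki.
  - by move=> y; exact: kp0.
  - exact: mpk.
  - by move=> y; exact: kp0.
  - exact: mpk.
  apply: ge0_le_integral => //.
  - by move=> y yt; apply: adde_ge0 => //; exact: kp0.
  - by apply: emeasurable_funD; exact: mpk.
  - apply: emeasurable_funD; last exact: mki.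
    by apply: emeasurable_funD; [exact: mV|exact: mpk].
  - move=> y; rewrite /= in_itv/= => /andP[y0 _].
    rewrite VE -!EFinM -!EFinD lee_fin; have [_] := key _ y0; lra.
have tjp : 1 <= t ^+ j by exact: exprn_ege1.
have tt : t <= t ^+ j.+1 by rewrite exprS ler_peMr.
have Cs : C * s <= e / 2 * t ^+ j.+1.
  apply: (@le_trans _ _ (e / 2 * t)); last by apply: ler_wpM2l => //; lra.
  by move: tC; rewrite ler_pdivrMr//; lra.
have tn : t ^+ j.+1 / j.+1%:R <= t ^+ j.+1.
  by rewrite ler_pdivrMr// ler_peMr ?exprn_ge0// ler1n.
have ee : e / 2 * (t ^+ j.+1 / j.+1%:R) <= e / 2 * t ^+ j.+1 by apply: ler_wpM2l => //; lra.
rewrite JE /= -(mulrA al) (mulrC (j.+2%:R)^-1) -(mulrA be) (mulrC (j.+1%:R)^-1).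
clear tn; move: (t ^+ j.+2 / _) (t ^+ j.+1 / _) upper lower ee => A B upper lower ee.
rewrite ler_norml; apply/andP; split; lra.
Qed.

End integral_expansion.

(** As [v] is of order [t ^ j.+1], its increments over a fixed length are only of
    order [t ^ j], and [e * v t] is a small multiple of [t ^ j.+1], which is the
    order of the second term of the expansion of [v']. *)
Lemma kernel_expansion (v J v' : R -> R) (al be m b : R) (j : nat) :
  0 <= al -> 0 < m -> expansion v al be j ->
  expansion J (al / j.+2%:R) (be / j.+1%:R) j.+1 ->
  (forall e : R, 0 < e -> exists s C : R, [/\ 0 <= s, 0 <= C &
     forall t : R, 0 <= t ->
     `|v' t - m^-1 * J t - b * v t| <= e * v t + C * (v t - v (t - s))]) ->
  expansion v' (al / (m * j.+2%:R)) (be / (m * j.+1%:R) + b * al) j.+1.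
Proof.
move=> al0 m0 ve Je v'e e e0.
pose K := `|be|.
have K0 : 0 <= K by exact: normr_ge0.
have b1 : be <= K by exact: ler_norm.
have b2 : - be <= K by rewrite /K -normrN ler_norm.
have [e1 e10 e1E] : exists2 e1 : R, 0 < e1 & e1 * (al + K + 1) = e / 4.
  have h : 0 < al + K + 1 by lra.
  by exists (e / 4 / (al + K + 1)); [rewrite divr_gt0//; lra|rewrite divfK// gt_eqF].
have [s [C [s0 C0 v'P]]] := v'e _ e10.
have me0 : 0 < m * (e / 4) by rewrite mulr_gt0//; lra.
have [sJ sJ0 JP] := Je _ me0.
have [sv sv0 vP] := ve _ ltr01.
(* [D * t ^+ j] collects the errors of lower order *)
have [D DE] : exists D : R, D = `|b| * (K + 1) + C * (al * (j.+1%:R * s) + 2 * K + 2) by eexists.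
have D0 : 0 <= D.
  rewrite DE addr_ge0// mulr_ge0//; first lra.
  by rewrite !addr_ge0// ?mulr_ge0// mulr_ge0.
exists (sJ + sv + s + 1 + 4 * D / e).
  by rewrite !addr_ge0// divr_ge0 ?mulr_ge0//; lra.
move=> t tL.
have De0 : 0 <= 4 * D / e by rewrite divr_ge0 ?mulr_ge0//; lra.
have t0 : 0 <= t by lra.
have t1 : 1 <= t by lra.
have ts0 : 0 <= t - s by lra.
have {}JP := JP t ltac:(lra).
have vt := vP t ltac:(lra).
have vts := vP (t - s) ltac:(lra).
have {}v'P := v'P t t0.
have pI := pow_increment j s0 (ltac:(lra) : s <= t).
have q0 : 0 <= t ^+ j by exact: exprn_ge0.
have q1 : t ^+ j <= t ^+ j.+1 by rewrite exprS ler_peMl.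
have q2 : 0 <= (t - s) ^+ j by exact: exprn_ge0.
have q3 : (t - s) ^+ j <= t ^+ j by apply: lerXn2r; rewrite ?nnegrE; lra.
have Dt : D * t ^+ j <= e / 4 * t ^+ j.+1.
  have h : 4 * D / e <= t by lra.
  move: h; rewrite ler_pdivrMr// => h.
  by rewrite exprS mulrA; apply: ler_wpM2r => //; lra.
have vbound : v t <= (al + K + 1) * t ^+ j.+1.
  have h1 : be * t ^+ j <= K * t ^+ j by apply: ler_wpM2r.
  have h2 : K * t ^+ j <= K * t ^+ j.+1 by apply: ler_wpM2l.
  by move: vt; rewrite ler_norml => /andP[]; lra.
have e1v : e1 * v t <= e / 4 * t ^+ j.+1.
  by rewrite -e1E -mulrA; apply: ler_wpM2l => //; exact: ltW.
have incr : v t - v (t - s) <= (al * (j.+1%:R * s) + 2 * K + 2) * t ^+ j.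
  have h1 : al * (t ^+ j.+1 - (t - s) ^+ j.+1) <= al * (j.+1%:R * s * t ^+ j) by exact: ler_wpM2l.
  have h2 : be * t ^+ j <= K * t ^+ j by apply: ler_wpM2r.
  have h3 : - be * (t - s) ^+ j <= K * (t - s) ^+ j by apply: ler_wpM2r.
  have h4 : K * (t - s) ^+ j <= K * t ^+ j by apply: ler_wpM2l.
  by move: vt vts; rewrite !ler_norml => /andP[? ?] /andP[? ?]; lra.
have Cincr : C * (v t - v (t - s)) <= C * (al * (j.+1%:R * s) + 2 * K + 2) * t ^+ j.
  by rewrite -mulrA; exact: ler_wpM2l.
have bv : `|b * v t - b * al * t ^+ j.+1| <= `|b| * (K + 1) * t ^+ j.
  rewrite -mulrA -mulrBr normrM -mulrA; apply: ler_wpM2l => //.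
  have h2 : be * t ^+ j <= K * t ^+ j by apply: ler_wpM2r.
  have h3 : - be * t ^+ j <= K * t ^+ j by apply: ler_wpM2r.
  by move: vt; rewrite !ler_norml => /andP[? ?]; apply/andP; split; lra.
have mJ : `|m^-1 * J t - (al / (m * j.+2%:R)) * t ^+ j.+2 - (be / (m * j.+1%:R)) * t ^+ j.+1| <= e / 4 * t ^+ j.+1.
  have -> : m^-1 * J t - (al / (m * j.+2%:R)) * t ^+ j.+2 - (be / (m * j.+1%:R)) * t ^+ j.+1 =
     m^-1 * (J t - al / j.+2%:R * t ^+ j.+2 - be / j.+1%:R * t ^+ j.+1).
    by rewrite !invfM; ring.
  rewrite normrM gtr0_norm ?invr_gt0// mulrC ler_pdivrMr//.
  by apply: le_trans JP _; rewrite le_eqVlt; apply/orP; left; apply/eqP; ring.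
have total : `|b| * (K + 1) * t ^+ j + C * (al * (j.+1%:R * s) + 2 * K + 2) * t ^+ j = D * t ^+ j.
  by rewrite DE; ring.
have eT0 : 0 <= e / 4 * t ^+ j.+1 by rewrite mulr_ge0; lra.
have -> : v' t - al / (m * j.+2%:R) * t ^+ j.+2 - (be / (m * j.+1%:R) + b * al) * t ^+ j.+1 =
  (v' t - m^-1 * J t - b * v t) + (b * v t - b * al * t ^+ j.+1) +
  (m^-1 * J t - (al / (m * j.+2%:R)) * t ^+ j.+2 - (be / (m * j.+1%:R)) * t ^+ j.+1).
  by move: (al / _) (be / _) => A B; ring.
apply: le_trans (ler_normD _ _) _; apply: le_trans (lerD (ler_normD _ _) (lexx _)) _.
apply: le_trans (lerD (lerD v'P bv) mJ) _.
clear -e1v Cincr total Dt eT0; lra.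
Qed.

End expansions.
(** * The law of the perturbed random walk *)

Section full_probability.
Context d (Om : measurableType d) (R : realType) (P : probability Om R).
Local Open Scope ereal_scope.

Lemma ae_prob1 (D : set Om) : measurable D ->
  {ae P, forall w, D w} <-> P D = 1.
Proof.
move=> mD; split=> [aeD|PD].
  have [N [mN N0 DN]] := aeD.
  have h : P (~` D) = 0.
    by apply: (subset_measure0 (measurableC mD) mN) => // w Dw; exact: DN.
  have := @probability_setC _ _ _ P _ (measurableC mD).
  by rewrite setCK h sube0.
exists (~` D); split => //; first exact: measurableC.
by rewrite probability_setC// PD subee.
Qed.

Lemma integral_full (D : set Om) (f : Om -> \bar R) :
  measurable D -> measurable_fun setT f -> P D = 1 ->
  \int[P]_(w in D) f w = \int[P]_w f w.
Proof.
move=> mD mf PD; rewrite integral_mkcond; apply: ae_eq_integral => //.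
  apply/(measurable_restrictT _ mD); exact: (@measurable_funS _ _ _ _ setT).
have /(ae_prob1 mD) := PD.
by apply: filterS => w Dw _; rewrite patchE mem_set.
Qed.

Lemma integral_law (U V : Om -> R) (g : R -> \bar R) :
  measurable_fun setT U -> measurable_fun setT V ->
  (forall A : set R, measurable A -> P (U @^-1` A) = P (V @^-1` A)) ->
  measurable_fun setT g -> (forall x, 0 <= g x) ->
  \int[P]_w g (U w) = \int[P]_w g (V w).
Proof.
move=> mU mV UV mg g0.
pose U' := RV_of P mU; pose V' := RV_of P mV.
rewrite -[LHS](@ge0_integral_distribution _ _ _ _ _ P U')//.
rewrite -[RHS](@ge0_integral_distribution _ _ _ _ _ P V')//.
by apply: eq_measure_integral => A mA _; exact: UV.
Qed.

End full_probability.

Lemma sum_iota (V : nmodType) (f : nat -> V) (n : nat) :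
  \sum_(k <- iota 0 n) f k = \sum_(k < n) f k.
Proof. by rewrite -(big_mkord xpredT f) /index_iota subn0. Qed.

Section perturbed_walk_law.
Context d (Om : measurableType d) (R : realType) (P : probability Om R).
Variables (X Y : Om -> R) (X_ Y_ : nat -> Om -> R).
Hypotheses (mX : measurable_fun setT X) (mY : measurable_fun setT Y).
Hypotheses (mX_ : forall i, measurable_fun setT (X_ i)).
Hypotheses (mY_ : forall i, measurable_fun setT (Y_ i)).
Hypothesis X0 : P [set w | 0 < X w] = 1%E.
Hypothesis Y0 : P [set w | 0 < Y w] = 1%E.
Hypothesis copies : independent_copies P
     (fun (i : nat) (w : Om) => (X_ i w, Y_ i w)) (fun w : Om => (X w, Y w)).
Local Open Scope ereal_scope.

Let lawX i (A : set R) : measurable A -> P (X_ i @^-1` A) = P (X @^-1` A).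
Proof.
move=> mA; have [_ /(_ i)] := copies.
move=> /(_ (fst @^-1` A)); apply.
by rewrite -[X in measurable X]setTI; exact: measurable_fst.
Qed.

Let lawY i (A : set R) : measurable A -> P (Y_ i @^-1` A) = P (Y @^-1` A).
Proof.
move=> mA; have [_ /(_ i)] := copies.
move=> /(_ (snd @^-1` A)); apply.
by rewrite -[X in measurable X]setTI; exact: measurable_snd.
Qed.

(** Replacing the [i]-th step by the [i]-th perturbation keeps independence, since
    the dependence is only within pairs. *)
Let Z (i k : nat) : Om -> R := if k == i then Y_ k else X_ k.

Let indepZ i : mutually_independent P (Z i).
Proof.
move=> J A uJ mA; have [ind _] := copies.
pose B k : set (R * R) := if k == i then snd @^-1` A k else fst @^-1` A k.
have BE k w : B k (X_ k w, Y_ k w) = A k (Z i k w).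
  by rewrite /B /Z; case: eqP.
have := ind J B uJ; rewrite (_ : \bigcap_(k in _) _ =
    \bigcap_(k in [set` J]) Z i k @^-1` A k); last first.
  by apply: eq_bigcapr => k _; apply/seteqP; split=> w /=; rewrite BE.
move=> ->.
  apply: eq_bigr => k _; congr (P _).
  by apply/seteqP; split => w /=; rewrite BE.
move=> k kJ; rewrite /B; case: eqP => _;
  rewrite -[X in measurable X]setTI.
  by apply: measurable_snd => //; exact: mA.
by apply: measurable_fst => //; exact: mA.
Qed.

Let mZ i k : measurable_fun setT (Z i k).
Proof. by rewrite /Z; case: eqP. Qed.

Let sumZ i w : (\sum_(k <- iota 0 i) Z i k w = \sum_(k < i) X_ k w)%R.
Proof.
rewrite sum_iota; by apply: eq_bigr => k _; rewrite /Z ltn_eqF.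
Qed.

Let mS n : measurable_fun setT (fun w => \sum_(k < n) X_ k w)%R.
Proof. exact: measurable_sum. Qed.

Let indepS i (W : nat -> Om -> R) (A B : set R) :
  (forall k, measurable_fun setT (W k)) -> mutually_independent P W ->
  (forall w, \sum_(k <- iota 0 i) W k w = \sum_(k < i) X_ k w)%R ->
  measurable A -> measurable B ->
  P (W i @^-1` A `&` (fun w => \sum_(k < i) X_ k w)%R @^-1` B) =
  P (W i @^-1` A) * P ((fun w => \sum_(k < i) X_ k w)%R @^-1` B).
Proof.
move=> mW iW WE mA mB.
rewrite setIC muleC.
have := @independent_sum_last _ _ _ P _ W mW iW (iota 0 i) i B A.
under eq_fun do rewrite WE.
apply => //; rewrite rcons_uniq iota_uniq andbT mem_iota add0n ltnn andbF//.
Qed.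

(** The last step is split off, while the recursion for [walk_cdf] conditions on
    the first one; the two agree since only the law of a step enters. *)
Lemma walk_cdfE n t : P [set w | (\sum_(k < n) X_ k w <= t)%R] = walk_cdf P X n t.
Proof.
elim: n t => [|n IH] t /=.
  under eq_set do rewrite big_ord0.
  by case: (leP 0%R t) => t0; [rewrite set_true probability_setT|rewrite set_false measure0].
transitivity (P [set w | (X_ n w + \sum_(k < n) X_ k w <= t)%R]).
  by under eq_set do rewrite big_ord_recr/= addrC.
rewrite convolution//; last first.
  move=> A B mA mB.
  pose W k := if k == n then X_ k else X_ k.
  have WE : X_ = W by apply/funext => k; rewrite /W; case: eqP.
  apply: indepS => //.
  - move=> J A' uJ mA'; have [ind _] := copies.
    have := ind J (fun k => fst @^-1` A' k) uJ; apply.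
    move=> k kJ; rewrite -[X in measurable X]setTI.
    by apply: measurable_fst => //; exact: mA'.
  - by move=> w; rewrite sum_iota.
under eq_integral do rewrite IH.
have mg : measurable_fun setT (fun x : R => walk_cdf P X n (t - x)%R).
  apply: (measurableT_comp (measurable_walk_cdf P mX n)).
  by apply: measurable_funB; [exact: measurable_cst|exact: measurable_id].
rewrite (@integral_law _ _ _ P (X_ n) X (fun x => walk_cdf P X n (t - x)%R))//.
- apply: esym; apply: (integral_full (measurable_gt_level mX _) _ X0).
  exact: (measurableT_comp mg mX).
- by move=> A; exact: lawX.
- by move=> x; exact: walk_cdf_ge0.
Qed.

Lemma perturbed_walk_cdf i t : P [set w | (perturbed_walk X_ Y_ i w <= t)%R] =
  \int[P]_(w in [set w | (0 < Y w)%R]) walk_cdf P X i (t - Y w)%R.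
Proof.
transitivity (P [set w | (Y_ i w + \sum_(k < i) X_ k w <= t)%R]).
  by apply: congr1; apply/seteqP; split=> w /=; rewrite /perturbed_walk addrC.
rewrite convolution//; last first.
  move=> A B mA mB.
  have := @indepS i (Z i) A B (mZ i) (@indepZ i) (sumZ i) mA mB.
  by rewrite /Z eqxx.
under eq_integral do rewrite walk_cdfE.
have mg : measurable_fun setT (fun x : R => walk_cdf P X i (t - x)%R).
  apply: (measurableT_comp (measurable_walk_cdf P mX i)).
  by apply: measurable_funB; [exact: measurable_cst|exact: measurable_id].
rewrite (@integral_law _ _ _ P (Y_ i) Y (fun x => walk_cdf P X i (t - x)%R))//.
- apply: esym; apply: (integral_full (measurable_gt_level mY _) _ Y0).
  exact: (measurableT_comp mg mY).
- by move=> A; exact: lawY.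
- by move=> x; exact: walk_cdf_ge0.
Qed.

Lemma perturbed_walk_mean t :
  \esum_(i in [set: nat]) P [set w | (perturbed_walk X_ Y_ i w <= t)%R] =
  delayed_renewal P X Y t.
Proof.
rewrite -nneseries_esumT//.
under eq_eseriesr do rewrite perturbed_walk_cdf.
rewrite -integral_nneseries//.
- exact: measurable_gt_level.
- by move=> n; apply: measurable_reflect => //; exact: measurable_walk_cdf.
- by move=> n w _; exact: walk_cdf_ge0.
Qed.

Lemma perturbed_walk_ge0 i : {ae P, forall w, (0 <= perturbed_walk X_ Y_ i w)%R}.
Proof.
have transfer (U V : Om -> R) : measurable_fun setT U -> measurable_fun setT V ->
    (forall A : set R, measurable A -> P (U @^-1` A) = P (V @^-1` A)) ->
    P [set w | (0 < V w)%R] = 1 -> {ae P, forall w, (0 <= U w)%R}.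
  move=> mU mV UV V0; apply/(ae_prob1 P (measurable_ge_level mU 0)).
  have E (W : Om -> R) : [set w | (0 <= W w)%R] = W @^-1` `[0%R, +oo[.
    by apply/seteqP; split => w /=; rewrite in_itv/= andbT.
  rewrite E UV -?E//; apply/(ae_prob1 P (measurable_ge_level mV 0)).
  have /(ae_prob1 P (measurable_gt_level mV 0)) := V0.
  by apply: filterS => w /ltW.
have aeX k : {ae P, forall w, (0 <= X_ k w)%R}.
  by apply: transfer (lawX k) X0.
have aeY k : {ae P, forall w, (0 <= Y_ k w)%R}.
  by apply: transfer (lawY k) Y0.
have := ae_foralln aeX; have := aeY i.
apply: filterS2 => w Yw Xw; rewrite /perturbed_walk addr_ge0//.
by apply: sumr_ge0 => k _; exact: Xw.
Qed.

End perturbed_walk_law.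
(** * Generations of the branching process *)

Section generations.
Context d (Om : measurableType d) (R : realType) (P : probability Om R).
Variables (T : seq nat -> nat -> Om -> R) (W : nat -> Om -> R).
Hypothesis mT : forall u i, measurable_fun setT (T u i).
Hypothesis mW : forall i, measurable_fun setT (W i).
Hypothesis W0 : forall i, {ae P, forall w, 0 <= W i w}.
Hypothesis tree : independent_copies P (fun u : seq nat => as_rseq (T u)) (as_rseq W).
Local Open Scope ereal_scope.

Let mcoord i (A : set R) : measurable A -> measurable [set x : rseq R | A (x i)].
Proof.
move=> mA; apply: sub_sigma_algebra; exists i => //.
by exists A => //; rewrite setTI.
Qed.

Let lawT u i (A : set R) : measurable A -> P (T u i @^-1` A) = P (W i @^-1` A).
Proof. by move=> mA; have [_ /(_ u _ (mcoord i mA))] := tree. Qed.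

Let T0 u i : {ae P, forall w, (0 <= T u i w)%R}.
Proof.
apply/(ae_prob1 P (measurable_ge_level (mT u i) 0)).
have E (V : Om -> R) : [set w | (0 <= V w)%R] = V @^-1` `[0%R, +oo[.
  by apply/seteqP; split => w /=; rewrite in_itv/= andbT.
by rewrite E lawT -?E//; apply/(ae_prob1 P (measurable_ge_level (mW i) 0)); exact: W0.
Qed.

Let mB u : measurable_fun setT (birth_time T u).
Proof. by apply: measurable_sum => k. Qed.

Lemma birth_time_ge0 u : P [set w | (0 <= birth_time T u w)%R] = 1.
Proof.
apply/(ae_prob1 P (measurable_ge_level (mB u) 0)).
have : {ae P, forall w (k : nat), (0 <= T (take k u) (nth 0%N u k) w)%R}.
  by apply: ae_foralln => k; exact: T0.
by apply: filterS => w Tw; apply: sumr_ge0 => k _; exact: Tw.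
Qed.

(** Seen from [rcons u i], each ancestor [v] contributes the delay of its child
    on the way to [rcons u i]; different ancestors contribute independently. *)
Let Z u i (v : seq nat) : Om -> R := T v (nth 0%N (rcons u i) (size v)).

Let indepZ u i : mutually_independent P (Z u i).
Proof.
move=> J A uJ mA; have [ind _] := tree.
have := ind J (fun v => [set x : rseq R | A v (x (nth 0%N (rcons u i) (size v)))]) uJ.
by apply => v vJ; apply: mcoord; exact: mA.
Qed.

Let prefixes (u : seq nat) := [seq take k u | k <- iota 0 (size u)].

Let birth_prefixes u i w : birth_time T u w = (\sum_(v <- prefixes u) Z u i v w)%R.
Proof.
rewrite /prefixes big_map sum_iota; apply: eq_bigr => k _.
by rewrite /Z size_take ltn_ord nth_rcons ltn_ord.
Qed.

Let uniq_prefixes u : uniq (rcons (prefixes u) u).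
Proof.
rewrite rcons_uniq; apply/andP; split.
  apply/mapP => -[k]; rewrite mem_iota add0n => /andP[_ ku] uE.
  by have := congr1 size uE; rewrite size_take ku => /eqP; rewrite gtn_eqF.
rewrite map_inj_in_uniq ?iota_uniq// => k l.
rewrite !mem_iota !add0n => /andP[_ ku] /andP[_ lu] /(congr1 size).
by rewrite !size_take ku lu.
Qed.

Lemma birth_time_rcons u i w : (birth_time T (rcons u i) w = birth_time T u w + T u i w)%R.
Proof.
rewrite /birth_time size_rcons big_ord_recr/= -cats1 take_size_cat// nth_cat ltnn subnn/=.
congr (_ + _)%R; apply: eq_bigr => k _.
by rewrite nth_cat ltn_ord takel_cat// ltnW.
Qed.

(** The delay [T u i] is independent of the birth time of [u], which involves
    the delays in families of strict ancestors of [u] only. *)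
Lemma birth_time_cdf u i t :
  P [set w | (birth_time T (rcons u i) w <= t)%R] =
  \int[P]_w P [set v | (W i v <= t - birth_time T u w)%R].
Proof.
under eq_set do rewrite birth_time_rcons.
rewrite convolution//.
  apply: eq_integral => w _.
  have E (V : Om -> R) (s : R) : [set w | (V w <= s)%R] = V @^-1` `]-oo, s].
    by apply/seteqP; split => v /=; rewrite in_itv.
  by rewrite !E lawT.
move=> A B mA mB'.
have mZ v : measurable_fun setT (Z u i v) by exact: mT.
have := @independent_sum_last _ _ _ P _ (Z u i) mZ (@indepZ u i) (prefixes u) u A B (uniq_prefixes u) mA mB'.
have -> : Z u i u = T u i by rewrite /Z nth_rcons ltnn eqxx.
by under eq_fun do rewrite -birth_prefixes.
Qed.

Definition generation (j : nat) : set (seq nat) := [set u | size u = j].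

Let le_ind u t : measurable_fun setT (fun w => (birth_time T u w <= t)%R%:R%:E : \bar R).
Proof. exact: (measurableT_comp (measurable_le_ind t) (mB u)). Qed.

Let le_indE u t : \int[P]_w (birth_time T u w <= t)%R%:R%:E =
  P [set w | (birth_time T u w <= t)%R].
Proof.
have mS : measurable [set w | (birth_time T u w <= t)%R].
  rewrite (_ : [set w | _] = birth_time T u @^-1` `]-oo, t]).
    by rewrite -[X in measurable X]setTI; exact: mB.
  by apply/seteqP; split => v /=; rewrite in_itv.
rewrite -[X in P X]setIT -integral_indic//; apply: eq_integral => w _.
rewrite indicE; congr ((nat_of_bool _)%:R%:E).
by apply/idP/idP; [move=> h; rewrite mem_set|move/set_mem].
Qed.

Lemma mean_count_cdf j t : mean_count P T j t =
  \esum_(u in generation j) P [set w | (birth_time T u w <= t)%R].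
Proof.
rewrite /mean_count.
transitivity (\int[P]_w \esum_(u in generation j) (birth_time T u w <= t)%R%:R%:E).
  apply: eq_integral => w _; rewrite /generation_count counting_esum.
  rewrite (_ : [set u | _ /\ _] = generation j `&` [set u | (birth_time T u w <= t)%R])//.
  rewrite esum_mkcondr; apply: eq_esum => u _.
  case: (boolP (birth_time T u w <= t)%R) => h; first by rewrite mem_set.
  by rewrite memNset//; exact/negP.
rewrite integral_esum//.
by apply: eq_esum => u _; rewrite le_indE.
Qed.

Lemma mean_count_campbell j t :
  mean_count P T j t = campbell_count P (generation j) (birth_time T) t.
Proof.
rewrite mean_count_cdf; apply: eq_esum => u _.
rewrite integral_full ?le_indE//; first exact: measurable_ge_level.
exact: birth_time_ge0.
Qed.

(** Each individual of generation [j] born at [x] has on average [G (t - x)]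
    children born before [t]. *)
Lemma mean_count_rec (G : R -> \bar R) j t : measurable_fun setT G ->
  (forall s, \esum_(i in [set: nat]) P [set w | (W i w <= s)%R] = G s) ->
  mean_count P T j.+1 t =
  campbell P (generation j) (birth_time T) (fun x => G (t - x)%R).
Proof.
move=> mG GE.
have mP i : measurable_fun setT (fun s : R => P [set w | (W i w <= s)%R]).
  apply: nondecreasing_emeasurable => s s' ss'.
  have mS r : measurable [set w | (W i w <= r)%R].
    rewrite (_ : [set w | _] = W i @^-1` `]-oo, r]).
      by rewrite -[X in measurable X]setTI; exact: mW.
    by apply/seteqP; split => v /=; rewrite in_itv.
  apply: le_measure; [exact: mem_set|exact: mem_set|].
  by move=> w /= /le_trans; apply.
rewrite mean_count_cdf.
rewrite (reindex_esum (generation j `*`` (fun=> [set: nat])) _ (fun p => rcons p.1 p.2)); last first.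
  split.
  - by move=> [u i] [/= uj _]; rewrite /generation/= size_rcons uj.
  - by move=> [u i] [v k] _ _ /= /rcons_inj[-> ->].
  - move=> v; rewrite /generation/=; case/lastP: v => // u i; rewrite size_rcons => -[uj].
    by exists (u, i).
rewrite -(@esum_esum _ _ _ _ _ (fun u i => P [set w | (birth_time T (rcons u i) w <= t)%R]))//.
apply: eq_esum => u _.
have mtB : measurable_fun setT (fun w => t - birth_time T u w)%R.
  by apply: measurable_funB.
under eq_esum do rewrite birth_time_cdf.
rewrite -integral_esum//.
  rewrite -(integral_full (measurable_ge_level (mB u) 0))//.
  - by apply: eq_integral => w _; rewrite GE.
  - apply: (eq_measurable_fun (fun w => G (t - birth_time T u w)%R)).
      by move=> w _; rewrite GE.
    exact: (measurableT_comp mG mtB).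
  - exact: birth_time_ge0.
by move=> i _; exact: (measurableT_comp (mP i) mtB).
Qed.

End generations.
(** * Asymptotics of the generation sizes *)

Section mean_count_asymptotics.
Context d (Om : measurableType d) (R : realType) (P : probability Om R).
Variables (T : seq nat -> nat -> Om -> R) (W : nat -> Om -> R).
Hypothesis mT : forall u i, measurable_fun setT (T u i).
Hypothesis mW : forall i, measurable_fun setT (W i).
Hypothesis W0 : forall i, {ae P, forall w, 0 <= W i w}.
Hypothesis tree : independent_copies P (fun u : seq nat => as_rseq (T u)) (as_rseq W).
Variables (G : R -> \bar R) (m b : R).
Hypothesis GE : forall s, (\esum_(i in [set: nat]) P [set w | (W i w <= s)%R] = G s)%E.
Hypothesis m0 : 0 < m.
Hypothesis G0 : forall x, (0 <= G x)%E.
Hypothesis Gmono : {homo G : s t / s <= t >-> (s <= t)%E}.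
Hypothesis Glt0 : forall x, x < 0 -> G x = 0%E.
Hypothesis Gfin : forall x, (G x < +oo)%E.
Hypothesis Gcvg : forall e : R, 0 < e -> exists2 s : R, 0 <= s &
  forall t : R, s <= t -> `|fine (G t) - t / m - b| <= e.

Let mB u : measurable_fun setT (birth_time T u).
Proof. by apply: measurable_sum => k. Qed.

Let mG : measurable_fun setT G.
Proof. exact: nondecreasing_emeasurable. Qed.

Lemma mean_count1 t : mean_count P T 1 t = G t.
Proof.
rewrite (mean_count_rec mT mW W0 tree _ _ mG GE).
have -> : generation 0 = [set [::]].
  by apply/seteqP; split => [u /size0nil|u ->].
rewrite /campbell esum_set1; last by apply: integral_ge0.
under eq_integral do rewrite /birth_time big_ord0 subr0.
rewrite (integral_full (measurable_ge_level (mB [::]) 0))//.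
  by rewrite integral_cst//= probability_setT mule1.
exact: (birth_time_ge0 mT mW W0 tree).
Qed.

(** If [al], [be] are the coefficients for generation [j.+1], those for the next
    one are [al / (m * j.+2)] and [be / (m * j.+1) + b * al]; the values stated
    here solve this recursion. *)
Lemma mean_count_expansion j :
  (forall t, (mean_count P T j.+1 t < +oo)%E) /\
  expansion (fun t => fine (mean_count P T j.+1 t))
    ((j.+1)`!%:R * m ^+ j.+1)^-1 (b * j.+1%:R / (j`!%:R * m ^+ j)) j.
Proof.
have mN0 : m != 0 by rewrite gt_eqF.
elim: j => [|j [Vfin IH]].
  split=> [t|e e0]; first by rewrite mean_count1.
  have [s s0 sP] := Gcvg e0; exists s => // t st.
  have := sP _ st; rewrite mean_count1 !fact0 expr0 !expr1 !mulr1 !mul1r divr1.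
  by rewrite [X in _ - X - _]mulrC.
have VE t : mean_count P T j.+1 t = campbell_count P (generation j.+1) (birth_time T) t.
  exact: (mean_count_campbell mT mW W0 tree).
have cfin t : (campbell_count P (generation j.+1) (birth_time T) t < +oo)%E.
  by rewrite -VE.
have V'E t : mean_count P T j.+2 t =
    campbell P (generation j.+1) (birth_time T) (fun x => G (t - x)).
  exact: (mean_count_rec mT mW W0 tree _ _ mG GE).
have kernel := campbell_kernel mB m0 G0 Gmono Glt0 Gfin Gcvg cfin.
split=> [t|].
  have [s [C [_ _ h]]] := kernel _ ltr01.
  have [t0|t0] := leP 0 t.
    by have [+ _] := h t t0; rewrite V'E ge0_fin_numE// campbell_ge0.
  rewrite V'E; apply: (@le_lt_trans _ _ (campbell P (generation j.+1) (birth_time T) (fun x => G (0 - x)))).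
    apply: le_campbell => //.
    - apply: (measurableT_comp mG).
      by apply: measurable_funB; [exact: measurable_cst|exact: measurable_id].
    - apply: (measurableT_comp mG).
      by apply: measurable_funB; [exact: measurable_cst|exact: measurable_id].
    - by move=> x _; apply: Gmono; rewrite lerD2r ltW.
  by have [+ _] := h 0 (lexx _); rewrite ge0_fin_numE// campbell_ge0.
have IH' : expansion (fine \o campbell_count P (generation j.+1) (birth_time T))
    ((j.+1)`!%:R * m ^+ j.+1)^-1 (b * j.+1%:R / (j`!%:R * m ^+ j)) j.
  by move=> e e0; have [s s0 sP] := IH e e0; exists s => // t /sP; rewrite VE.
have al0 : 0 <= ((j.+1)`!%:R * m ^+ j.+1)^-1.
  by rewrite invr_ge0 mulr_ge0// exprn_ge0// ltW.
have Jexp := integral_expansion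
  (@campbell_count_ge0 _ _ _ P _ (generation j.+1) (birth_time T))
  (@campbell_count_mono _ _ _ P _ (generation j.+1) _ mB) cfin al0 IH'.
have -> : ((j.+2)`!%:R * m ^+ j.+2)^-1 = ((j.+1)`!%:R * m ^+ j.+1)^-1 / (m * j.+2%:R).
  by rewrite (factS j.+1) natrM (exprS m j.+1) !invfM; ring.
have -> : b * j.+2%:R / ((j.+1)`!%:R * m ^+ j.+1) =
    (b * j.+1%:R / (j`!%:R * m ^+ j)) / (m * j.+1%:R) + b * ((j.+1)`!%:R * m ^+ j.+1)^-1.
  have jN0 : j.+1%:R != 0 :> R by rewrite pnatr_eq0.
  have fN0 : j`!%:R != 0 :> R by rewrite pnatr_eq0 -lt0n fact_gt0.
  have pN0 : m ^+ j != 0 by rewrite expf_neq0.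
  rewrite (factS j) natrM (exprS m j) -(@natr1 _ j.+1).
  move: (j.+1%:R) (j`!%:R) (m ^+ j) jN0 fN0 pN0 => x y z x0 y0 z0.
  by field; rewrite ?x0 ?y0 ?z0 ?mN0.
apply: (kernel_expansion al0 m0 IH' Jexp) => e e0.
have [s [C [s0 C0 h]]] := kernel e e0; exists s, C; split => // t t0.
by have [_] := h t t0; rewrite V'E.
Qed.

End mean_count_asymptotics.

Lemma expansion_cvg (R : realType) (v : R -> R) (al be c : R) (j : nat) :
  c != 0 -> expansion v al be j ->
  (v t - al * t ^+ j.+1) / (c * t ^+ j) @[t --> +oo] --> be / c.
Proof.
move=> c0 ve; apply/cvgrPdist_le => e e0.
have ec0 : 0 < e * `|c| by rewrite mulr_gt0// normr_gt0.
have [s s0 sP] := ve _ ec0.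
near=> t.
have t1 : 1 <= t by near: t; apply: nbhs_pinfty_ge; exact: num_real.
have st : s <= t by near: t; apply: nbhs_pinfty_ge; exact: num_real.
have tj : 0 < t ^+ j by rewrite exprn_gt0//; lra.
have tN0 : t ^+ j != 0 by rewrite gt_eqF.
have -> : be / c - (v t - al * t ^+ j.+1) / (c * t ^+ j) =
   - ((v t - al * t ^+ j.+1 - be * t ^+ j) / (c * t ^+ j)).
  by move: (t ^+ j.+1) (t ^+ j) tN0 => x y y0; field; rewrite c0 y0.
rewrite normrN normrM normfV ler_pdivrMr ?normr_gt0 ?mulf_neq0//.
by rewrite normrM (gtr0_norm tj) mulrA sP.
Unshelve. all: by end_near. Qed.
Theorem theorem2p2 (d : measure_display) (Om : measurableType d) (R : realType)
  (P : probability Om R)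
  (xi eta : {RV P >-> R}) (xi_ eta_ : nat -> {RV P >-> R})
  (T : seq nat -> nat -> {RV P >-> R})
  (xi_gt0 : {ae P, forall w, 0 < xi w})
  (eta_gt0 : {ae P, forall w, 0 < eta w})
  (copies : independent_copies P
     (fun (i : nat) (w : Om) => (xi_ i w, eta_ i w))
     (fun w : Om => (xi w, eta w)))
  (tree : independent_copies P
     (fun u : seq nat => as_rseq (T u))
     (as_rseq (perturbed_walk xi_ eta_)))
  (xi_nonlattice : nonlattice (distribution P xi))
  (xi_L2 : ('E_P[fun w => (xi w ^+ 2)%R] < +oo)%E)
  (eta_L1 : ('E_P[eta] < +oo)%E)
  (j : nat) (j_gt0 : (0 < j)%N) :
  let m : R := fine 'E_P[xi]%E in
  let b : R := m^-1 * (fine 'E_P[fun w => (xi w ^+ 2)%R]%E / (2 * m) - fine 'E_P[eta]%E) in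
  let f : R -> \bar R := fun t =>
    (mean_count P T j t - (t ^+ j / (j`!%:R * m ^+ j))%:E)%E in
  (* for b = 0 the relation f ~ 0 is read as f(t) = o(t^(j-1)) *)
  (b != 0 -> asymp_equiv f (fun t =>
     b * j%:R * t ^+ j.-1 / ((j.-1)`!%:R * m ^+ j.-1))) /\
  (b = 0 -> asymp_negligible f (fun t =>
     j%:R * t ^+ j.-1 / ((j.-1)`!%:R * m ^+ j.-1))).
Proof.
move=> m b f.
have mxi : measurable_fun setT xi by [].
have meta : measurable_fun setT eta by [].
have xi1 : P [set w | 0 < xi w] = 1%E.
  by apply/(ae_prob1 P (measurable_gt_level mxi 0)).
have eta1 : P [set w | 0 < eta w] = 1%E.
  by apply/(ae_prob1 P (measurable_gt_level meta 0)).
pose D := [set w | 0 < xi w].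
have mD : measurable D by exact: measurable_gt_level.
pose D' := [set w | 0 < eta w].
have mD' : measurable D' by exact: measurable_gt_level.
have mxi2 : measurable_fun setT (fun w => xi w ^+ 2) by exact: measurable_funX.
have X2E : (\int[P]_(w in D) (xi w ^+ 2)%:E = (fine 'E_P[fun w => (xi w ^+ 2)%R])%:E)%E.
  rewrite integral_full//; last exact/measurable_EFinP.
  rewrite fineK; first by rewrite unlock.
  rewrite ge0_fin_numE// unlock; apply: integral_ge0 => w _.
  by rewrite lee_fin sqr_ge0.
have XE : (\int[P]_(w in D) (xi w)%:E = m%:E)%E.
  rewrite /m -[in RHS](_ : \int[P]_(w in D) (xi w)%:E = 'E_P[xi])%E; last first.
    by rewrite integral_full ?unlock//; exact/measurable_EFinP.
  rewrite fineK// ge0_fin_numE; last by apply: integral_ge0 => w /= /ltW.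
  (* [x <= 1 + x ^ 2] *)
  apply: (@le_lt_trans _ _ (\int[P]_(w in D) (1 + (xi w ^+ 2)%:E)))%E.
    apply: ge0_le_integral => //.
    - by move=> w /= /ltW; rewrite lee_fin.
    - apply: (@measurable_funS _ _ _ _ setT) => //; exact/measurable_EFinP.
    - apply: (@measurable_funS _ _ _ _ setT) => //; apply: emeasurable_funD => //.
      exact/measurable_EFinP.
    - move=> w _; rewrite -EFinD lee_fin.
      by have := sqr_ge0 (xi w - 1); rewrite expr2 => h; nra.
  rewrite ge0_integralD//; last 2 first.
  - by move=> w _; rewrite lee_fin sqr_ge0.
  - apply: (@measurable_funS _ _ _ _ setT) => //; exact/measurable_EFinP.
  by rewrite X2E integral_cst//= xi1 mule1 -EFinD ltry.
have YE : (\int[P]_(w in D') (eta w)%:E = (fine 'E_P[eta])%:E)%E.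
  have E : (\int[P]_(w in D') (eta w)%:E = 'E_P[eta])%E.
    by rewrite integral_full ?unlock//; exact/measurable_EFinP.
  by rewrite E fineK// ge0_fin_numE// -E; apply: integral_ge0 => w /= /ltW.
have m0 : 0 < m by exact: mean_gt0 XE.
have cvgG := delayed_renewal_cvg mxi meta xi1 eta1 XE X2E YE xi_nonlattice.
have mxi_ i : measurable_fun setT (xi_ i) by [].
have meta_ i : measurable_fun setT (eta_ i) by [].
have mT u i : measurable_fun setT (T u i) by [].
have mW i : measurable_fun setT (perturbed_walk xi_ eta_ i).
  by apply: measurable_funD => //; exact: measurable_sum.
have W0 := perturbed_walk_ge0 mxi meta mxi_ meta_ xi1 eta1 copies.
have GE := perturbed_walk_mean mxi meta mxi_ meta_ xi1 eta1 copies.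
have Gfin x : (delayed_renewal P xi eta x < +oo)%E.
  by rewrite -ge0_fin_numE ?delayed_renewal_ge0// delayed_renewal_fin.
have gmono : {homo delayed_renewal P xi eta : x y / x <= y >-> (x <= y)%E}.
  exact: delayed_renewal_mono.
have glt0 (x : R) : x < 0 -> delayed_renewal P xi eta x = 0%E.
  exact: delayed_renewal_lt0.
have [k jE] : exists k, j = k.+1 by exists j.-1; rewrite prednK.
have [Vfin Vexp] := mean_count_expansion mT mW W0 tree GE m0
  (@delayed_renewal_ge0 _ _ _ P xi eta) gmono glt0 Gfin cvgG k.
pose v t := fine (mean_count P T k.+1 t).
have vE t : mean_count P T j t = (v t)%:E.
  rewrite jE /v fineK// ge0_fin_numE//; apply: integral_ge0 => w _.
  by rewrite /generation_count counting_esum esum_ge0.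
have lim c : c != 0 ->
    (f t * ((c * t ^+ j.-1)^-1)%:E)%E @[t --> +oo] -->
    ((b * j%:R / ((j.-1)`!%:R * m ^+ j.-1)) / c)%:E.
  move=> c0.
  have -> : (fun t => (f t * ((c * t ^+ j.-1)^-1)%:E)%E) =
      EFin \o (fun t => (v t - (j`!%:R * m ^+ j)^-1 * t ^+ j) / (c * t ^+ j.-1)).
    by apply/funext => t; rewrite /f vE /= -EFinB -EFinM (mulrC (t ^+ j)).
  apply: cvg_EFin; first by near=> t.
  by rewrite jE /=; exact: expansion_cvg.
pose c0 := (j.-1)`!%:R * m ^+ j.-1.
have c0N0 : c0 != 0.
  by rewrite mulf_neq0// ?expf_neq0 ?gt_eqF// ?ltr0n ?fact_gt0.
have jN0 : j%:R != 0 :> R by rewrite pnatr_eq0 -lt0n.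
have swap (x t : R) : x * t ^+ j.-1 / c0 = x / c0 * t ^+ j.-1 by rewrite mulrAC.
split=> [bN0|b0].
- have cN0 : b * j%:R / c0 != 0 by rewrite mulf_neq0// ?invr_neq0// mulf_neq0.
  have := lim _ cN0; rewrite divff// /asymp_equiv => L.
  by under eq_fun do rewrite swap.
- have cN0 : j%:R / c0 != 0 by rewrite mulf_neq0// invr_neq0.
  have := lim _ cN0; rewrite b0 !mul0r /asymp_negligible => L.
  by under eq_fun do rewrite swap.
Unshelve. all: by end_near. Qed.
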